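(* Let $\mathscr{R}=(\Xi^0,\mathcal{R})$ be a deterministic iterated graph system that is primitive (that is, $\mathbf{M}$ and all matrices in $\mathcal{D}$ are primitive), and let $\Xi$ be its graph limit. Then \[ \dim_B(\Xi)=\dim_H(\Xi)=\frac{\log\rho(\mathbf{M})}{\log\rho_{\min}(\mathcal{D})}, \] where $\rho(\cdot)$ denotes the spectral radius. In particular the limit defining $\dim_B(\Xi)$ exists.
   Context: Graphs are directed, weakly connected, without self-loops or multiple edges. Distances $\mathrm{d}_G$ and the diameter $\Delta(G)$ of a directed graph are those of the underlying undirected graph, each edge having length $1$. Deterministic iterated graph system: a pair $\mathscr{R}=(\Xi^0,\mathcal{R})$, where, for some $\lambda\in\mathbb{N}$, every arc carries a colour in $\{1,\dots,\lambda\}$; $\Xi^0$ is a finite directed arc-coloured graph with at least one arc; and $\mathcal{R}=\{R_i\}_{i=1}^{\lambda}$ is a family of finite directed arc-coloured graphs, each with two distinguished nodes $A,B$ satisfying $\mathrm{d}_{R_i}(A,B)\ge 2$. Given $\Xi^{n}$, the graph $\Xi^{n+1}$ is obtained by replacing, for every colour $i$, each $i$-coloured arc $e$ of $\Xi^n$ by a fresh copy of $R_i$, with $A$ identified with the beginning node of $e$ and $B$ with its ending node. Thus $V(\Xi^0)\subset V(\Xi^1)\subset\cdots$. For a graph or path $G$, $\boldsymbol{\chi}(G)\in\mathbb{Z}_{\ge0}^\lambda$ is the row vector whose $j$-th entry is the number of $j$-coloured arcs of $G$. $\mathbf{M}=(m_{ij})$ is the $\lambda\times\lambda$ matrix with $m_{ij}=[\boldsymbol{\chi}(R_i)]_j$.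 $\mathcal{P}_i$ is the set of simple paths between $A$ and $B$ in the underlying undirected graph of $R_i$; $\mathcal{V}_i=\{\boldsymbol{\chi}(P):P\in\mathcal{P}_i\}$; $\mathcal{D}$ is the set of all $\lambda\times\lambda$ matrices whose $i$-th row is an element of $\mathcal{V}_i$ for every $i$ (rows chosen independently). $\rho_{\min}(\mathcal{D})=\min\{\rho(\mathbf{D}):\mathbf{D}\in\mathcal{D}\}$. Scaled graph: for finite $G$, $\hat G$ is $G$ with every arc given weight $1/\Delta(G)$, so $\Delta(\hat G)=1$. Limit: $\Xi=\lim_n\Xi^n$ has $V(\Xi)=\bigcup_n V(\Xi^n)$, and $\hat\Xi$ has the metric $\mathrm{d}_{\hat\Xi}(u,v)=\lim_{n\to\infty}\mathrm{d}_{\Xi^n}(u,v)/\Delta(\Xi^n)$. An arc of $\Xi$ is a sequence $(e_n)_{n\ge0}$ with $e_n$ an arc of $\Xi^n$ and $e_{n+1}$ one of the arcs of the copy of a rule graph that replaces $e_n$; arcs of $\hat\Xi$ have weight $0$, and such an arc is regarded as the point of the metric completion of $(V(\Xi),\mathrm{d}_{\hat\Xi})$ to which the end nodes of the $e_n$ converge. A box is a subgraph $U$ (a set of nodes and arcs); its diameter $\Delta(U)$ is measured with $\mathrm{d}_{\hat\Xi}$. Minkowski dimension: $N_\ell(\hat\Xi)$ is the minimum number of boxes of diameter strictly less than $\ell$ whose node sets cover $V(\hat\Xi)$, and $\dim_B(\Xi)=\lim_{\ell\to0}\frac{\log N_\ell(\hat\Xi)}{-\log\ell}$. Hausdorff dimension: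 $\mathcal{HV}^s(\Xi)=\lim_{\delta\to0}\inf\{\sum_i\Delta(U_i)^s\}$ over countable families $\{U_i\}$ of boxes with $\Delta(U_i)\le\delta$ and $V(\hat\Xi)\subset\bigcup_iV(U_i)$; $\mathcal{HE}^s(\Xi)$ is defined in the same way but with the requirement $E(\hat\Xi)\subset\bigcup_iE(U_i)$. $\dim_{HV}(\Xi)=\inf\{s\ge0:\mathcal{HV}^s(\Xi)=0\}$, $\dim_{HE}(\Xi)=\inf\{s\ge0:\mathcal{HE}^s(\Xi)=0\}$, and $\dim_H(\Xi)=\max\{\dim_{HV}(\Xi),\dim_{HE}(\Xi)\}$. *)

(* Defs.v *)
From HB Require Import structures.
From mathcomp Require Import all_boot all_order all_algebra.
From mathcomp Require Import complex.
From mathcomp Require Import all_classical all_reals all_analysis.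

Set Implicit Arguments.
Unset Strict Implicit.
Unset Printing Implicit Defensive.

Import Order.TTheory GRing.Theory Num.Theory.
Import numFieldNormedType.Exports.

Local Open Scope classical_set_scope.
Local Open Scope ring_scope.

Record cgraph (lam : nat) := CGraph {
  gnode : finType;
  garc : finType;
  abeg : garc -> gnode;
  aend : garc -> gnode;
  color : garc -> 'I_lam }.

Arguments abeg {lam} c.
Arguments aend {lam} c.
Arguments color {lam} c.

Section Graphs.
Variable lam : nat.
Implicit Type G : cgraph lam.

(* The arc e, with its direction forgotten, joins x to y. *)
Definition joins G (e : garc G) (x y : gnode G) : bool :=
  ((abeg G e == x) && (aend G e == y)) || ((abeg G e == y) && (aend G e == x)).

Definition adj G : rel (gnode G) := fun x y => [exists e, joins e x y].

(* Opposite arcs u -> v and v -> u are not multiple arcs. *)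
Definition wf_cgraph G : Prop :=
  [/\ forall e, abeg G e != aend G e,
      injective (fun e => (abeg G e, aend G e)) &
      forall x y, connect (@adj G) x y].

Definition has_walk G (x y : gnode G) (k : nat) : bool :=
  [exists p : k.-tuple (gnode G), path (@adj G) x p && (last x p == y)].

(* A shortest walk has fewer steps than G has nodes; the value is the junk
   #|gnode G| when y is not reachable from x. *)
Definition gdist G (x y : gnode G) : nat :=
  find (has_walk x y) (iota 0 #|gnode G|).

Definition gdiam G : nat :=
  (\max_(x : gnode G) \max_(y : gnode G) gdist x y)%N.

Definition chi_graph G : 'rV[nat]_lam :=
  \row_j #|[set e : garc G | color G e == j]%SET|.

(* Walks of the underlying undirected graph record the arcs they use: an entry
   (e, y) is a step along e arriving at y. *)
Fixpoint is_walk G (x : gnode G) (p : seq (garc G * gnode G)) : bool :=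
  if p is (e, y) :: p' then joins e x y && is_walk y p' else true.

Definition simple_path_between G (x y : gnode G)
    (p : seq (garc G * gnode G)) : bool :=
  [&& is_walk x p, last x (unzip2 p) == y & uniq (x :: unzip2 p)].

Definition chi_path G (p : seq (garc G * gnode G)) : 'rV[nat]_lam :=
  \row_j count (fun s => color G s.1 == j) p.

End Graphs.

Record rule (lam : nat) := Rule {
  rgraph :> cgraph lam;
  nodeA : gnode rgraph;
  nodeB : gnode rgraph }.

Record igs (lam : nat) := IGS {
  start : cgraph lam;
  rules : 'I_lam -> rule lam }.

Arguments rules {lam} i _.

Definition wf_igs (lam : nat) (S : igs lam) : Prop :=
  [/\ wf_cgraph (start S),
      (0 < #|garc (start S)|)%N,
      forall i, wf_cgraph (rules S i) &
      forall i, (2 <= gdist (nodeA (rules S i)) (nodeB (rules S i)))%N].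

Section Substitution.
Variables (lam : nat) (S : igs lam).

Definition inner (i : 'I_lam) : Type :=
  {w : gnode (rules S i) | (w != nodeA (rules S i)) && (w != nodeB (rules S i))}.

Section Step.
Variable G : cgraph lam.

Definition new_node : finType := {e : garc G & inner (color G e)}.
Definition sub_node : finType := (gnode G + new_node)%type.
Definition sub_arc : finType := {e : garc G & garc (rules S (color G e))}.

(* The node of the substituted graph that the node w of the copy of the rule
   graph replacing e becomes. *)
Definition place (e : garc G) (w : gnode (rules S (color G e))) : sub_node :=
  if (insub w : option (inner (color G e))) is Some w'
  then inr (existT (fun e => inner (color G e)) e w')
  else inl (if w == nodeA (rules S (color G e)) then abeg G e else aend G e).

Definition subst_graph : cgraph lam :=
  @CGraph lam sub_node sub_arc
    (fun a => place (abeg (rules S (color G (tag a))) (tagged a)))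
    (fun a => place (aend (rules S (color G (tag a))) (tagged a)))
    (fun a => color (rules S (color G (tag a))) (tagged a)).

End Step.

Fixpoint Xi (n : nat) : cgraph lam :=
  if n is n'.+1 then subst_graph (Xi n') else start S.

(* The union of the increasing sequence V(Xi 0) c V(Xi 1) c ...: a node of the
   limit is a node of Xi 0, or is born when some Xi n is substituted. *)
Definition lnode : countType :=
  (gnode (start S) + {n : nat & new_node (Xi n)})%type.

Fixpoint to_lnode (n : nat) : gnode (Xi n) -> lnode :=
  match n return gnode (Xi n) -> lnode with
  | 0 => fun v => inl v
  | n'.+1 => fun v => match v with
                      | inl u => @to_lnode n' u
                      | inr w => inr (existT (fun m => new_node (Xi m)) n' w)
                      end
  end.

Record larc := LArc {
  larc_seq :> forall n, garc (Xi n);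
  larcP : forall n, tag (larc_seq n.+1 : sub_arc (Xi n)) = larc_seq n }.

(* Distance in Xi n of two nodes of the limit; the value 0 is junk, for the
   finitely many n such that x or y is not yet in Xi n. *)
Definition level_dist (n : nat) (x y : lnode) : nat :=
  if [pick p : gnode (Xi n) * gnode (Xi n)
      | (to_lnode p.1 == x) && (to_lnode p.2 == y)] is Some p
  then gdist p.1 p.2 else 0%N.

Definition Mmx : 'M[nat]_lam := \matrix_(i, j) chi_graph (rules S i) 0 j.

Definition Vset (i : 'I_lam) : set 'rV[nat]_lam :=
  [set chi_path p | p in
     [set p | simple_path_between (nodeA (rules S i)) (nodeB (rules S i)) p]].

Definition Dset : set 'M[nat]_lam := [set D | forall i, Vset i (row i D)].

Definition primitive_mx (A : 'M[nat]_lam) : Prop :=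
  exists2 k : nat, (0 < k)%N & forall i j, (0 < (A ^+ k) i j)%N.

Definition primitive_igs : Prop :=
  primitive_mx Mmx /\ (forall D, Dset D -> primitive_mx D).

End Substitution.

Section Dimensions.
Variables (R : realType) (lam : nat).

(* The complex eigenvalues form a finite set, nonempty when lam > 0, so that
   the supremum is a maximum. *)
Definition spectral_radius (A : 'M[nat]_lam) : R :=
  sup [set ComplexField.Normc.normc z | z in
    [set z : complex R
       | eigenvalue (map_mx (fun m : nat => m%:R) A) z]].

Variable S : igs lam.

(* Dset S is finite and nonempty, so that the infimum is a minimum. *)
Definition rho_min : R := inf [set spectral_radius D | D in Dset S].

Definition ldist (x y : lnode S) : R :=
  limn (fun n => (level_dist n x y)%:R / (gdiam (Xi S n))%:R : R).

(* Nodes and arcs of the limit are both points of the metric completion; a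
   point is handled through the sequence of nodes that converges to it, an arc
   (e_n) being the limit of the beginnings of the e_n (the endings have the
   same limit). *)
Definition lpoint : Type := (lnode S + larc S)%type.

Definition rep_node (p : lpoint) (n : nat) : lnode S :=
  match p with
  | inl x => x
  | inr e => to_lnode (abeg (Xi S n) (e n))
  end.

Definition pdist (p q : lpoint) : R :=
  limn (fun n => ldist (rep_node p n) (rep_node q n)).

Record box := Box { bnodes : set (lnode S); barcs : set (larc S) }.

Definition box_points (U : box) : set lpoint :=
  [set inl x | x in bnodes U] `|` [set inr e | e in barcs U].

(* The diameter of the empty box is 0. *)
Definition box_diam (U : box) : R :=
  sup [set pdist p q | p in box_points U & q in box_points U].

Definition coverable (l : R) (k : nat) : Prop :=
  exists U : 'I_k -> box,
    (forall i, box_diam (U i) < l) /\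
    setT `<=` \bigcup_(i in [set: 'I_k]) bnodes (U i).

(* The least k such that coverable l k (0 if there is none). *)
Definition Nbox (l : R) : nat :=
  xget 0%N [set k | coverable l k /\ forall j, coverable l j -> (k <= j)%N].

Definition box_ratio (l : R) : R := ln (Nbox l)%:R / (- ln l).

Definition dimB : R := lim (box_ratio l @[l --> (0 : R)^'+]).

(* Countable families are indexed by sets of natural numbers. *)
Definition hausdorff_pre (T : Type) (part : box -> set T) (s delta : R)
    : \bar R :=
  ereal_inf [set h | exists (I : set nat) (U : nat -> box),
    [/\ forall i, I i -> box_diam (U i) <= delta,
        setT `<=` \bigcup_(i in I) part (U i) &
        h = \esum_(i in I) (box_diam (U i) `^ s)%:E]].

Definition hausdorff_measure (T : Type) (part : box -> set T) (s : R)
    : \bar R :=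
  lim (hausdorff_pre part s delta @[delta --> (0 : R)^'+]).

Definition hausdorff_dim (T : Type) (part : box -> set T) : \bar R :=
  ereal_inf [set s%:E | s in
    [set s : R | 0 <= s /\ hausdorff_measure part s = 0%E]].

Definition dimHV : \bar R := hausdorff_dim bnodes.
Definition dimHE : \bar R := hausdorff_dim barcs.
Definition dimH : \bar R := maxe dimHV dimHE.

End Dimensions.

Arguments box_ratio R {lam} S l.

(* Main.v *)
Require Import Defs.
From HB Require Import structures.
From mathcomp Require Import all_boot all_order all_algebra complex.
From mathcomp Require Import all_classical all_reals all_analysis.
From mathcomp Require Import ring lra.
Import Order.TTheory GRing.Theory Num.Theory.
Import numFieldNormedType.Exports.
Local Open Scope classical_set_scope.
Local Open Scope ring_scope.

Set Implicit Arguments.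
Unset Strict Implicit.
Unset Printing Implicit Defensive.

(** Let rho be the minimal spectral radius of a path selection D and v its
    Perron vector. By minimality no other selection is better in any row, so
    that v is an eigenvector of the concave recursion obeyed by the distances
    between the ends of a substituted arc. These distances are then asymptotic
    to a multiple of v * rho ^ n: the extreme ratios to v are monotone, and the
    positivity of a power of the single matrix D closes the gap between them.
    Hence the limit metric restricted to V(Xi n) is the graph metric weighted
    by v / rho ^ n, up to a constant; a potential on Xi n that is 1-Lipschitz
    for these weights extends to Xi (n+1) without leaving the range of its
    values at the ends of the arc, which gives all lower bounds on distances.

    Since V(Xi n) is separated at scale rho ^ -n, is dense at scale rho ^ -n
    and has about rho(M) ^ n points, the box dimension follows, as well as the
    upper bound on the Hausdorff dimension. The degrees being unbounded, a small
    ball may meet many cylinders, so for the lower bound one keeps, inside each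
    arc, only the descendants of an interior arc; k levels at a time this costs
    a constant factor that does not depend on k. The words that remain form a
    Cantor set to which the mass distribution principle applies, and k tends to
    infinity. *)

(** * Weighted distances in finite graphs *)

(** The recursion for the distances is concave but not linear, since the optimal path through a rule
    graph may change from level to level; a fixed selection D gives upper bounds only. A shortest
    path of a substituted graph may also wander through many copies, so no walk is ever cut into
    pieces: upper bounds transport distances along maps of graphs, lower bounds exhibit potentials.
    The condition d(A, B) >= 2 acts twice. It gives rho >= 2 and rho(M) >= 2, which lets geometric
    sums of errors and of node counts be absorbed by their last term. It also gives an inner node
    next to each of A and B, so that two substitutions inside an arc produce an arc with both ends
    in the interior. The set of nodes is countable, and covers by single nodes, of diameter 0, make
    dim_HV vanish. The lower bound on dim_H must therefore come from the arcs, which is why infinite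
    words are turned into arcs of the limit. *)

Definition connected_graph (lam : nat) (G : cgraph lam) : Prop :=
  forall x y, connect (@adj lam G) x y.

Section Walks.
Variables (R : realType) (lam : nat).
Implicit Types (G : cgraph lam) (w : 'I_lam -> R).

Definition cost G w (p : seq (garc G * gnode G)) : R :=
  \sum_(s <- p) w (color G s.1).

Definition wdist G w (x y : gnode G) : R :=
  inf [set cost w p | p in [set p | is_walk x p /\ last x (unzip2 p) = y]].

Lemma joins_beg_end G (e : garc G) : joins e (abeg G e) (aend G e).
Proof. by rewrite /joins !eqxx. Qed.

Lemma joins_end_beg G (e : garc G) : joins e (aend G e) (abeg G e).
Proof. by rewrite /joins !eqxx orbT. Qed.

Lemma joins_ends G (e : garc G) x y : joins e x y ->
  (abeg G e = x /\ aend G e = y) \/ (abeg G e = y /\ aend G e = x).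
Proof. by case/orP => /andP[/eqP -> /eqP ->]; [left|right]. Qed.

Lemma adj_sym G : symmetric (@adj lam G).
Proof.
by move=> x y; apply/existsP/existsP => -[e H]; exists e; move: H;
  rewrite /joins orbC.
Qed.

Lemma path_walk G (x : gnode G) (s : seq (gnode G)) :
  path (@adj lam G) x s -> exists p, is_walk x p /\ unzip2 p = s.
Proof.
elim: s x => [|y s IH] x /=; first by exists [::].
case/andP => /existsP[e exy] /IH[p [pw ps]].
by exists ((e, y) :: p); rewrite /= exy pw ps.
Qed.

Lemma walk_path G (x : gnode G) p :
  is_walk x p -> path (@adj lam G) x (unzip2 p).
Proof.
elim: p x => [|[e y] p IH] x //= /andP[exy /IH ->].
by rewrite andbT; apply/existsP; exists e.
Qed.

Lemma walk_cat G (x : gnode G) p q :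
  is_walk x (p ++ q) = is_walk x p && is_walk (last x (unzip2 p)) q.
Proof.
by elim: p x => [|[e y] p IH] x //=; rewrite IH andbA.
Qed.

Lemma cost_ge0 G w (p : seq (garc G * gnode G)) :
  (forall i, 0 <= w i) -> 0 <= cost w p.
Proof. by move=> w0; apply: sumr_ge0. Qed.

(** Loop erasure from the far end: the tail is already simple, and if it revisits the starting node
    [x], everything before that visit is dropped. Nonnegative weights make this no dearer. *)
Lemma walk_shorten G w (x : gnode G) p : (forall i, 0 <= w i) ->
  is_walk x p -> exists q,
    simple_path_between x (last x (unzip2 p)) q /\ cost w q <= cost w p.
Proof.
move=> w0; elim: p x => [|[e y] p IH] x /=.
  by exists [::]; rewrite /simple_path_between /= eqxx.
case/andP => exy /IH[q [/and3P[qw /eqP ql qu] qp]].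
have le_cost : cost w q <= cost w ((e, y) :: p).
  by rewrite [X in _ <= X]big_cons /=; apply: le_trans qp _; rewrite lerDr.
have [xq|xq] := boolP (x \in y :: unzip2 q); last first.
  exists ((e, y) :: q); split.
    by rewrite /simple_path_between [is_walk _ _]/= exy qw /= ql eqxx xq.
  by rewrite /cost !big_cons lerD2l.
move: xq; rewrite inE => /orP[/eqP xy|xq].
  exists q; split=> //; rewrite /simple_path_between xy qw ql eqxx /=.
  by move: qu.
case/splitPr: {-2}(unzip2 q) / (xq) (erefl (unzip2 q)) => s1 s2 qE.
pose q1 := take (size s1).+1 q; pose q2 := drop (size s1).+1 q.
have q1E : unzip2 q1 = rcons s1 x.
  rewrite /q1 /unzip2 map_take -/(unzip2 q) -qE -cat_rcons.
  by rewrite take_size_cat ?size_rcons.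
have q2E : unzip2 q2 = s2.
  rewrite /q2 /unzip2 map_drop -/(unzip2 q) -qE -cat_rcons.
  by rewrite drop_size_cat ?size_rcons.
have qq : q = q1 ++ q2 by rewrite cat_take_drop.
exists q2; split.
  move: qw; rewrite {1}qq walk_cat q1E last_rcons => /andP[_ q2w].
  rewrite /simple_path_between q2w /= q2E.
  move: ql qu; rewrite -qE last_cat /= => -> /=; rewrite eqxx /=.
  by case/andP => _; rewrite cat_uniq => /and3P[_ _].
apply: le_trans (_ : cost w q <= _) => //; rewrite [in leRHS]qq /cost big_cat /= lerDr.
exact: cost_ge0.
Qed.

Lemma wdist_le G w (x : gnode G) p : (forall i, 0 <= w i) ->
  is_walk x p -> wdist w x (last x (unzip2 p)) <= cost w p.
Proof.
move=> w0 pw; apply: ge_inf; last by exists p.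
by exists 0 => _ [q _ <-]; apply: cost_ge0.
Qed.

Lemma ex_simple_path G (x y : gnode G) : connected_graph G ->
  exists p, simple_path_between x y p.
Proof.
move=> Gc; have /connectP[s xs ->] := Gc x y.
have [p [pw <-]] := path_walk xs.
have [//|q [qP _]] := @walk_shorten G (fun=> 0) x p _ pw.
by exists q.
Qed.

Lemma simple_path_size G (x y : gnode G) p :
  simple_path_between x y p -> (size p < #|gnode G|)%N.
Proof.
case/and3P => _ _ /card_uniqP; rewrite /= size_map => <-.
exact: max_card.
Qed.

(** Loop erasure reduces the infimum to simple paths. Their length is bounded by the number of
    nodes, so they live in a finite type of bounded sequences, where a minimum exists. *)
Lemma wdist_attained G w (x y : gnode G) :
  connected_graph G -> (forall i, 0 <= w i) ->
  exists p, simple_path_between x y p /\ cost w p = wdist w x y.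
Proof.
move=> Gc w0; have [p0 p0P] := ex_simple_path x y Gc.
pose N := #|gnode G|.
pose T := {bseq N of garc G * gnode G}.
have p0N : (size p0 <= N)%N by apply: ltnW (simple_path_size p0P).
pose P := [pred t : T | simple_path_between x y (t : seq _)].
have P0 : P (Bseq p0N) by [].
case: (@Order.TotalTheory.arg_minP _ _ _ (Bseq p0N) P (fun t : T => cost w t) P0).
move=> t tP tmin; exists t; split => //; apply/eqP.
rewrite eq_le; apply/andP; split; last first.
  case/and3P: tP => tw /eqP <- _; exact: wdist_le.
apply: lb_le_inf.
  by exists (cost w t); exists t => //; case/and3P: tP => ? /eqP ? _; split.
move=> _ [q [qw qy] <-].
have [q' []] := walk_shorten w0 qw; rewrite qy => q'P; apply: le_trans.
have q'N : (size q' <= N)%N by apply: ltnW (simple_path_size q'P).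
exact: (tmin (Bseq q'N)).
Qed.

Definition arc_lipschitz G w (f : gnode G -> R) :=
  forall e : garc G, `|f (abeg G e) - f (aend G e)| <= w (color G e).

Lemma lipschitz_joins G w (f : gnode G -> R) e x y : arc_lipschitz w f ->
  joins e x y -> `|f x - f y| <= w (color G e).
Proof.
by move=> fL /joins_ends[] [<- <-]; last rewrite distrC; apply: fL.
Qed.

Lemma lipschitz_walk G w (f : gnode G -> R) x p : arc_lipschitz w f ->
  is_walk x p -> `|f x - f (last x (unzip2 p))| <= cost w p.
Proof.
move=> fL; elim: p x => [|[e y] p IH] x /=.
  by rewrite subrr normr0 /cost big_nil.
case/andP => exy /IH H; rewrite /cost big_cons /=.
rewrite (_ : f x - _ = (f x - f y) + (f y - f (last y (unzip2 p)))).
  apply: le_trans (ler_normD _ _) _; apply: lerD => //.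
  exact: lipschitz_joins exy.
by rewrite addrA subrK.
Qed.

Section Distance.
Variables (G : cgraph lam) (w : 'I_lam -> R).
Hypotheses (Gc : connected_graph G) (w0 : forall i, 0 <= w i).

Lemma lipschitz_wdist (f : gnode G -> R) x y : arc_lipschitz w f ->
  `|f x - f y| <= wdist w x y.
Proof.
move=> fL; have [p [/and3P[pw /eqP <- _] <-]] := wdist_attained x y Gc w0.
exact: lipschitz_walk.
Qed.

Lemma wdist_ge0 (x y : gnode G) : 0 <= wdist w x y.
Proof.
by have [p [_ <-]] := wdist_attained x y Gc w0; apply: cost_ge0.
Qed.

Lemma wdistxx (x : gnode G) : wdist w x x = 0.
Proof.
apply/eqP; rewrite eq_le wdist_ge0 andbT.
by have := @wdist_le G w x [::] w0 isT; rewrite /cost big_nil.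
Qed.

Lemma wdist_step (x y z : gnode G) e : joins e y z ->
  wdist w x z <= wdist w x y + w (color G e).
Proof.
move=> eyz; have [p [/and3P[pw /eqP py _] <-]] := wdist_attained x y Gc w0.
have := @wdist_le G w x (rcons p (e, z)) w0.
rewrite -cats1 walk_cat pw py /= eyz => /(_ isT).
by rewrite /unzip2 map_cat last_cat /= /cost big_cat big_seq1.
Qed.

Lemma wdist_lipschitz (x : gnode G) : arc_lipschitz w (wdist w x).
Proof.
move=> e; rewrite ler_norml; apply/andP; split.
  by rewrite lerBrDr addrC lerBlDr; apply: wdist_step; apply: joins_beg_end.
by rewrite lerBlDr addrC; apply: wdist_step; apply: joins_end_beg.
Qed.

Lemma wdistC (x y : gnode G) : wdist w x y = wdist w y x.
Proof.
suff le (x' y' : gnode G) : wdist w x' y' <= wdist w y' x'.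
  by apply/eqP; rewrite eq_le !le.
have := lipschitz_wdist y' x' (@wdist_lipschitz x').
by rewrite wdistxx subr0 ger0_norm // wdist_ge0.
Qed.

Lemma wdist_triangle (y x z : gnode G) :
  wdist w x z <= wdist w x y + wdist w y z.
Proof.
rewrite addrC -lerBlDr [wdist w y z]wdistC.
by apply: le_trans (ler_norm _) (lipschitz_wdist _ _ (@wdist_lipschitz x)).
Qed.

Lemma wdist_ge (c : R) (x y : gnode G) : x != y -> (forall i, c <= w i) ->
  c <= wdist w x y.
Proof.
move=> xy cw; have [p [/and3P[pw /eqP py _] <-]] := wdist_attained x y Gc w0.
case: p pw py => [_ /= E|s p _ _]; first by rewrite E eqxx in xy.
by rewrite /cost big_cons -[c]addr0 lerD // cost_ge0.
Qed.

Lemma wdist_bounded (c : R) (x y : gnode G) : (forall i, w i <= c) -> 0 <= c ->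
  wdist w x y <= c *+ #|gnode G|.
Proof.
move=> wc c0; have [p [pP <-]] := wdist_attained x y Gc w0.
apply: (@le_trans _ _ (c *+ size p)).
  rewrite /cost; elim: (p) => [|s q IH]; first by rewrite big_nil.
  by rewrite big_cons /= mulrS lerD.
by apply: ler_wpMn2l => //; apply: ltnW (simple_path_size pP).
Qed.

End Distance.

Lemma wdist_mono G w1 w2 (x y : gnode G) : connected_graph G ->
  (forall i, 0 <= w1 i) -> (forall i, w1 i <= w2 i) ->
  wdist w1 x y <= wdist w2 x y.
Proof.
move=> Gc w0 w12; have w20 i : 0 <= w2 i by apply: le_trans (w12 i).
have [p [/and3P[pw /eqP <- _] <-]] := wdist_attained x y Gc w20.
by apply: le_trans (wdist_le w0 pw) _; apply: ler_sum.
Qed.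

Lemma wdist_scale G w (c : R) (x y : gnode G) : connected_graph G ->
  0 <= c -> (forall i, 0 <= w i) ->
  wdist (fun i => c * w i) x y = c * wdist w x y.
Proof.
move=> Gc; rewrite le_eqVlt => /orP[/eqP <-|c0] w0.
  rewrite mul0r; apply/eqP; rewrite eq_le wdist_ge0 ?andbT //; last first.
    by move=> i; rewrite mul0r.
  have := @wdist_bounded G (fun i => 0 * w i) Gc _ 0 x y.
  by rewrite mul0rn; apply=> // i; rewrite mul0r.
have H (k : R) (u : 'I_lam -> R) : 0 < k -> (forall i, 0 <= u i) ->
    wdist (fun i => k * u i) x y <= k * wdist u x y.
  move=> k0 u0; have [p [/and3P[pw /eqP <- _] <-]] := wdist_attained x y Gc u0.
  have ku0 i : 0 <= k * u i by rewrite mulr_ge0 // ltW.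
  by apply: le_trans (wdist_le ku0 pw) _; rewrite /cost mulr_sumr.
apply/eqP; rewrite eq_le H //=.
have cw0 i : 0 <= c * w i by rewrite mulr_ge0 // ltW.
have := H c^-1 (fun i => c * w i) _ cw0; rewrite invr_gt0 => /(_ c0).
rewrite ler_pdivlMl //; under [X in wdist X]eq_fun do rewrite mulKf ?gt_eqF //.
by [].
Qed.

(** The distance from [h x] pulled back along [h] is a potential on [G], so that it suffices to
    control single arcs. The map is meant to be the inclusion of a graph, or of one copy of a rule
    graph, in the substituted graph. *)
Lemma wdist_map G G' w w' (h : gnode G -> gnode G') (x y : gnode G) :
  connected_graph G -> connected_graph G' ->
  (forall i, 0 <= w i) -> (forall i, 0 <= w' i) ->
  (forall e, wdist w' (h (abeg G e)) (h (aend G e)) <= w (color G e)) ->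
  wdist w' (h x) (h y) <= wdist w x y.
Proof.
move=> Gc Gc' w0 w'0 hw.
have fL : arc_lipschitz w (fun u => wdist w' (h x) (h u)).
  move=> e; apply: le_trans (hw e).
  exact: (lipschitz_wdist Gc' w'0 _ _ (wdist_lipschitz Gc' w'0 (h x))).
have := lipschitz_wdist Gc w0 y x fL.
by rewrite wdistxx // subr0 ger0_norm ?wdist_ge0 // [wdist w y x]wdistC.
Qed.

(** Brings the combinatorial distance into the weighted setting. A minimizing simple path has fewer
    steps than there are nodes, so the default value of [gdist] does not occur. *)
Lemma gdist_wdist G (x y : gnode G) : connected_graph G ->
  (gdist x y)%:R = wdist (fun=> 1) x y :> R.
Proof.
move=> Gc; have o0 (i : 'I_lam) : 0 <= 1 :> R by [].
have costE (p : seq (garc G * gnode G)) : cost (fun=> 1) p = (size p)%:R :> R.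
  by rewrite /cost big_const_seq count_predT iter_addr_0.
have [p [pP pd]] := wdist_attained x y Gc o0.
have pN := simple_path_size pP; case/and3P: pP => pw py _.
have pw' : has_walk x y (size p).
  apply/existsP.
  have st : size (unzip2 p) == size p by rewrite size_map.
  by exists (Tuple st); rewrite /= walk_path.
apply/eqP; rewrite eq_le; apply/andP; split.
  rewrite -pd costE ler_nat /gdist leqNgt; apply/negP => lt.
  have := before_find 0%N lt; rewrite nth_iota // add0n pw'.
  by [].
have hs : has (has_walk x y) (iota 0 #|gnode G|).
  by apply/hasP; exists (size p) => //; rewrite mem_iota.
have lt : (gdist x y < #|gnode G|)%N by rewrite -[X in (_ < X)%N](size_iota 0) -has_find.
have := nth_find 0%N hs; rewrite -/(gdist x y) nth_iota // add0n.
case/existsP => t /andP[/path_walk[q [qw qt]] /eqP ty].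
have := @wdist_le G (fun=> 1) x q o0 qw; rewrite qt ty costE.
by rewrite -(size_map snd) -/(unzip2 q) qt size_tuple.
Qed.

End Walks.

Lemma connect_map (lam : nat) (G G' : cgraph lam) (h : gnode G -> gnode G') x y :
  (forall e, connect (@adj lam G') (h (abeg G e)) (h (aend G e))) ->
  connect (@adj lam G) x y -> connect (@adj lam G') (h x) (h y).
Proof.
move=> H /connectP[s xs ->]; elim: s x xs => [|z s IH] x //= /andP[xz /IH zs].
apply: connect_trans zs; case/existsP: xz => e /joins_ends[] [<- <-] //.
by rewrite (sym_connect_sym (@adj_sym _ _)).
Qed.

(** * Substitution and weighted distances *)

Section Substitution.
Variables (R : realType) (lam : nat) (S : igs lam).
Hypothesis wfS : wf_igs S.
Implicit Types (G : cgraph lam) (w : 'I_lam -> R).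

Lemma rule_connected i : connected_graph (rules S i).
Proof. by case: wfS => _ _ /(_ i)[]. Qed.

Lemma start_connected : connected_graph (start S).
Proof. by case: wfS => -[]. Qed.

Lemma gdistxx G (x : gnode G) : gdist x x = 0%N.
Proof.
rewrite /gdist; case E: #|gnode G| => [//|n] /=.
suff -> : has_walk x x 0 by [].
by apply/existsP; exists [tuple] => /=.
Qed.

Lemma nodeAB i : nodeA (rules S i) != nodeB (rules S i).
Proof.
case: wfS => _ _ _ /(_ i); apply: contraTneq => ->.
by rewrite gdistxx.
Qed.

Section Place.
Variable G : cgraph lam.
Implicit Types e : garc G.
Local Notation put e u := (@place lam S G e u).

Lemma placeA e : put e (nodeA (rules S (color G e))) = inl (abeg G e).
Proof. by rewrite /place insubN ?eqxx. Qed.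

Lemma placeB e : put e (nodeB (rules S (color G e))) = inl (aend G e).
Proof.
by rewrite /place insubN ?eqxx ?andbF // eq_sym (negbTE (nodeAB _)).
Qed.

Lemma place_inner e (w : inner S (color G e)) :
  put e (val w) = inr (existT (fun e => inner S (color G e)) e w).
Proof. by rewrite /place valK. Qed.

Variant place_spec e (u : gnode (rules S (color G e))) : sub_node S G -> Type :=
| PlaceA of u = nodeA _ : place_spec u (inl (abeg G e))
| PlaceB of u = nodeB _ : place_spec u (inl (aend G e))
| PlaceInner (w : inner S (color G e)) of u = val w :
    place_spec u (inr (existT (fun e => inner S (color G e)) e w)).

Lemma placeP e u : place_spec u (put e u).
Proof.
have [E|uA] := eqVneq u (nodeA (rules S (color G e))).
  by rewrite [X in place X]E placeA; constructor.
have [E|uB] := eqVneq u (nodeB (rules S (color G e))).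
  by rewrite [X in place X]E placeB; constructor.
have H : (u != nodeA (rules S (color G e))) && (u != nodeB (rules S (color G e))).
  by rewrite uA.
have -> : put e u = put e (val (exist _ u H : inner S (color G e))) by [].
by rewrite place_inner; constructor.
Qed.

Lemma subst_connected : connected_graph G -> connected_graph (subst_graph S G).
Proof.
move=> Gc.
have Rc e u v : connect (@adj _ (subst_graph S G)) (put e u) (put e v).
  apply: (connect_map (G := rules S (color G e))); last exact: rule_connected.
  move=> a; apply: connect1; apply/existsP.
  by exists (existT _ e a); rewrite /joins /= !eqxx.
have Lc x y : connect (@adj _ (subst_graph S G)) (inl x) (inl y).
  apply: (connect_map (G := G)); last exact: Gc.
  by move=> e; rewrite -placeA -placeB; apply: Rc.
have csym := sym_connect_sym (@adj_sym _ (subst_graph S G)).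
have base z : exists x, connect (@adj _ (subst_graph S G)) z (inl x).
  case: z => [x|[e u]]; first by exists x; apply: connect0.
  by exists (abeg G e); rewrite -place_inner -placeA.
move=> y z; have [y' yy'] := base y; have [z' zz'] := base z.
apply: connect_trans yy' _; apply: connect_trans (Lc y' z') _.
by rewrite csym.
Qed.

End Place.

Lemma Xi_connected n : connected_graph (Xi S n).
Proof.
by elim: n => [|n IH] /=; [exact: start_connected | exact: subst_connected].
Qed.

(* The weight that a colour inherits when each arc of the substituted graph is
   given the weight w of its colour. *)
Definition sub_weight w : 'I_lam -> R :=
  fun i => wdist w (nodeA (rules S i)) (nodeB (rules S i)).

Lemma sub_weight_ge0 w i : (forall j, 0 <= w j) -> 0 <= sub_weight w i.
Proof. by move=> w0; apply: wdist_ge0 => //; apply: rule_connected. Qed.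

Lemma sub_weight_mono w1 w2 : (forall j, 0 <= w1 j) -> (forall j, w1 j <= w2 j) ->
  forall i, sub_weight w1 i <= sub_weight w2 i.
Proof. by move=> w0 w12 i; apply: wdist_mono => //; apply: rule_connected. Qed.

Lemma sub_weight_scale w (c : R) : 0 <= c -> (forall j, 0 <= w j) ->
  sub_weight (fun j => c * w j) = (fun i => c * sub_weight w i).
Proof.
by move=> c0 w0; apply/funext => i; apply: wdist_scale => //; apply: rule_connected.
Qed.

Lemma min_lipschitz (x y x' y' k : R) : `|x - x'| <= k -> `|y - y'| <= k ->
  `|Num.min x y - Num.min x' y'| <= k.
Proof.
rewrite !ler_norml !minEle => /andP[? ?] /andP[? ?].
by case: ifPn; case: ifPn; rewrite -?ltNge => ? ?; apply/andP; split; lra.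
Qed.

Section Extension.
Variables (G : cgraph lam) (w : 'I_lam -> R) (f : gnode G -> R).
Hypotheses (w0 : forall i, 0 <= w i).
Hypothesis fL : arc_lipschitz (sub_weight w) f.

(** A McShane extension of the values [a] at A and [b] at B: the lower of two distance cones,
    truncated at the larger end value. The truncation keeps the range within that of the ends; when
    |a - b| is at most the distance from A to B, both end values are preserved. *)
Definition ext_rule (a b : R) i (u : gnode (rules S i)) : R :=
  Num.min (Num.max a b)
    (Num.min (a + wdist w (nodeA (rules S i)) u)
             (b + wdist w (nodeB (rules S i)) u)).

Definition ext_node (z : sub_node S G) : R :=
  match z with
  | inl x => f x
  | inr (existT e u) => ext_rule (f (abeg G e)) (f (aend G e)) (val u)
  end.

Lemma ext_place e u : ext_node (@place lam S G e u) =
  ext_rule (f (abeg G e)) (f (aend G e)) u.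
Proof.
have Rc := @rule_connected (color G e).
have H := fL e; rewrite /sub_weight in H.
case: placeP => [E|E|? -> //]; rewrite /= /ext_rule E wdistxx // addr0.
  rewrite (wdistC Rc w0); move: H; rewrite ler_norml => /andP[H1 H2].
  rewrite (_ : Num.min (f (abeg G e)) _ = f (abeg G e)).
    by rewrite minC minEle le_max lexx.
  by rewrite minEle ifT //; lra.
move: H; rewrite ler_norml => /andP[H1 H2].
rewrite (_ : Num.min (_ + _) _ = f (aend G e)).
  by rewrite minC minEle le_max lexx orbT.
by rewrite minC minEle ifT //; lra.
Qed.

Lemma ext_lipschitz : arc_lipschitz (G := subst_graph S G) w ext_node.
Proof.
move=> [e a] /=; rewrite !ext_place /ext_rule.
have Rc := @rule_connected (color G e).
have L x := @wdist_lipschitz _ _ _ _ Rc w0 x a.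
apply: min_lipschitz; first by rewrite subrr normr0.
by apply: min_lipschitz; rewrite opprD addrACA subrr add0r; apply: L.
Qed.

Lemma ext_range (a : garc (subst_graph S G)) lo hi :
  lo <= f (abeg G (tag a)) <= hi -> lo <= f (aend G (tag a)) <= hi ->
  lo <= ext_node (abeg (subst_graph S G) a) <= hi /\
  lo <= ext_node (aend (subst_graph S G) a) <= hi.
Proof.
case: a => e a /= /andP[a1 a2] /andP[b1 b2].
have Rc := @rule_connected (color G e).
have H (u : gnode (rules S (color G e))) : lo <= ext_rule (f (abeg G e)) (f (aend G e)) u <= hi.
  have A0 := wdist_ge0 Rc w0 (nodeA (rules S (color G e))) u.
  have B0 := wdist_ge0 Rc w0 (nodeB (rules S (color G e))) u.
  rewrite /ext_rule !le_min !ge_min !le_max ge_max a1 a2 b2 /=.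
  by apply/andP; split; lra.
by rewrite !ext_place.
Qed.

End Extension.

(** For the upper bound, each copy of a rule graph maps into the substituted graph without
    increasing distances. For the lower bound, the distance from [x] in [G], a potential for the
    inherited weights, is extended to the new nodes. *)
Lemma wdist_subst G w x y : connected_graph G -> (forall i, 0 <= w i) ->
  wdist (G := subst_graph S G) w (inl x) (inl y) = wdist (sub_weight w) x y.
Proof.
move=> Gc w0; have Sc := subst_connected Gc.
have F0 i := sub_weight_ge0 i w0.
apply/eqP; rewrite eq_le; apply/andP; split.
  apply: (wdist_map (h := inl) (G' := subst_graph S G)) => // e.
  rewrite -placeA -placeB.
  apply: (wdist_map (h := @place lam S G e) (G' := subst_graph S G)) => //.
    exact: rule_connected.
  move=> a; pose a' : garc (subst_graph S G) := existT _ e a.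
  have := @wdist_step R lam (subst_graph S G) w Sc w0 _ _ _ a' (joins_beg_end a').
  by move=> /(_ (abeg (subst_graph S G) a')); rewrite wdistxx // add0r.
have fL := @wdist_lipschitz R lam G (sub_weight w) Gc F0 x.
have := lipschitz_wdist Sc w0 (inl x) (inl y) (ext_lipschitz w0 fL).
by rewrite /= wdistxx // sub0r normrN ger0_norm // wdist_ge0.
Qed.

End Substitution.

(** * Perron-Frobenius theory *)

Section Perron.
Variables (R : realType) (lam : nat).
Implicit Types (A : 'M[nat]_lam) (x y u v : 'I_lam -> R).

Definition act A x : 'I_lam -> R := fun i => \sum_j (A i j)%:R * x j.

Lemma act_mono A x y : (forall i, x i <= y i) -> forall i, act A x i <= act A y i.
Proof. by move=> xy i; apply: ler_sum => j _; apply: ler_wpM2l. Qed.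

Lemma act_scale A c x : act A (fun i => c * x i) = (fun i => c * act A x i).
Proof.
by apply/funext => i; rewrite /act mulr_sumr; apply: eq_bigr => j _; rewrite mulrCA.
Qed.

Lemma iter_act A k x i : iter k (act A) x i = \sum_j ((A ^+ k) i j)%:R * x j.
Proof.
elim: k i => [|k IH] i /=.
  rewrite expr0 (bigD1 i) //= big1 ?addr0 ?mxE ?eqxx ?mul1r // => j ji.
  by rewrite !mxE eq_sym (negbTE ji) mul0r.
transitivity (\sum_j \sum_l (A i j)%:R * (((A ^+ k) j l)%:R * x l)).
  by apply: eq_bigr => j _; rewrite IH mulr_sumr.
rewrite exchange_big /=; apply: eq_bigr => j _.
rewrite exprS mxE natr_sum mulr_suml; apply: eq_bigr => l _.
by rewrite natrM mulrA.
Qed.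

Lemma iter_act_eigen A k t y : (forall i, act A y i = t * y i) ->
  forall i, iter k (act A) y i = t ^+ k * y i.
Proof.
move=> Ay; elim: k => [|k IH] i /=; first by rewrite expr0 mul1r.
have -> : iter k (act A) y = (fun i => t ^+ k * y i) by apply/funext.
by rewrite act_scale Ay exprS mulrA [t * _]mulrC.
Qed.

(* Collatz-Wielandt comparison, evaluated where u i / y i is maximal. *)
Lemma ratio_argmax u y (i0 : 'I_lam) : (forall i, 0 < y i) ->
  (forall i, 0 <= u i) -> 0 < u i0 ->
  exists j m, [/\ 0 < m, u j = m * y j & forall i, u i <= m * y i].
Proof.
move=> y0 u0 ui0.
case: (@Order.TotalTheory.arg_maxP _ _ _ i0 xpredT (fun i => u i / y i)) => // j _ jmax.
exists j, (u j / y j); split.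
- apply: lt_le_trans (jmax i0 isT).
  by rewrite divr_gt0.
- by rewrite divfK // gt_eqF.
- by move=> i; rewrite -ler_pdivrMr //; exact: jmax.
Qed.

Lemma cw_le A u y s t (i0 : 'I_lam) : (forall i, 0 < y i) ->
  (forall i, act A y i <= t * y i) -> (forall i, 0 <= u i) -> 0 < u i0 ->
  (forall i, s * u i <= act A u i) -> s <= t.
Proof.
move=> y0 Ay u0 ui0 Au; have [j [m [m0 uj um]]] := ratio_argmax y0 u0 ui0.
have uj0 : 0 < u j by rewrite uj mulr_gt0.
rewrite -(ler_pM2r uj0); apply: le_trans (Au j) _.
apply: le_trans (act_mono A um j) _; rewrite act_scale uj mulrCA.
by rewrite ler_pM2l.
Qed.

Lemma cw_lt A u y s t (i0 : 'I_lam) : (forall i, 0 < y i) ->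
  (forall i, act A y i < t * y i) -> (forall i, 0 <= u i) -> 0 < u i0 ->
  (forall i, s * u i <= act A u i) -> s < t.
Proof.
move=> y0 Ay u0 ui0 Au; have [j [m [m0 uj um]]] := ratio_argmax y0 u0 ui0.
have uj0 : 0 < u j by rewrite uj mulr_gt0.
rewrite -(ltr_pM2r uj0); apply: le_lt_trans (Au j) _.
apply: le_lt_trans (act_mono A um j) _; rewrite act_scale uj mulrCA.
by rewrite ltr_pM2l.
Qed.

Lemma iter_act_pos A k x (j : 'I_lam) : (forall i j, (0 < (A ^+ k) i j)%N) ->
  (forall i, 0 <= x i) -> 0 < x j -> forall i, 0 < iter k (act A) x i.
Proof.
move=> Ak x0 xj i; rewrite iter_act (bigD1 j) //= ltr_wpDr //.
  by apply: sumr_ge0 => l _; rewrite mulr_ge0.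
by rewrite mulr_gt0 // ltr0n.
Qed.

Lemma act_iterB A k x y i :
  iter k (act A) (fun i => x i - y i) i = iter k (act A) x i - iter k (act A) y i.
Proof. by rewrite !iter_act -sumrB; apply: eq_bigr => j _; rewrite mulrBr. Qed.

Lemma iter_act_scale A k c x i :
  iter k (act A) (fun i => c * x i) i = c * iter k (act A) x i.
Proof. by rewrite !iter_act mulr_sumr; apply: eq_bigr => j _; rewrite mulrCA. Qed.

(** Collatz-Wielandt variational principle by compactness: the pairs (u, r) with u in the simplex, 0
    <= r <= B and r u <= A u form a compact set, on which r attains its maximum. Scaling a
    competitor to sum 1 brings it into this set. *)
Lemma max_subeigenvector A (i0 : 'I_lam) : exists (r : R) u,
  [/\ 0 <= r, forall i, 0 <= u i, exists j, 0 < u j,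
      forall i, r * u i <= act A u i &
      forall s v, (forall i, 0 <= v i) -> (exists j, 0 < v j) ->
        (forall i, s * v i <= act A v i) -> s <= r].
Proof.
(* The sum of all entries bounds every admissible factor, by comparison with the constant vector
   1. *)
pose B : R := \sum_i \sum_j (A i j)%:R.
have B0 : 0 <= B by apply: sumr_ge0 => i _; apply: sumr_ge0.
have sB s v : (forall i, 0 <= v i) -> (exists j, 0 < v j) ->
    (forall i, s * v i <= act A v i) -> s <= B.
  move=> v0 [j vj] Av; apply: (@cw_le A v (fun=> 1) s B j) => // i.
  rewrite mulr1 /act /B; under eq_bigr do rewrite mulr1.
  rewrite [leRHS](bigD1 i) //= lerDl; apply: sumr_ge0 => k _; exact: sumr_ge0.
pose K : set ('rV[R]_lam) := [set v | forall i, `[0, 1]%classic (v ord0 i)].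
pose g i (z : 'rV[R]_lam * R) := z.2 * z.1 ord0 i - \sum_j (A i j)%:R * z.1 ord0 j.
pose h (z : 'rV[R]_lam * R) := \sum_j z.1 ord0 j.
pose P := (K `*` `[0, B]%classic) `&`
  ((\bigcap_i g i @^-1` [set r | r <= 0]) `&` h @^-1` [set 1]).
have coordC j : continuous (fun z : 'rV[R]_lam * R => z.1 ord0 j).
  move=> z; apply: (@continuous_comp _ _ _ fst (fun v : 'rV[R]_lam => v ord0 j)).
    exact: cvg_fst.
  exact: coord_continuous.
have hC : continuous h.
  by move=> z; apply: (@cvg_big R 'I_lam +%R 0 xpredT add_continuous) => // j _; apply: coordC.
have gC i : continuous (g i).
  move=> z; apply: cvgB; first by apply: cvgM; [exact: cvg_snd|exact: coordC].
  apply: (@cvg_big R 'I_lam +%R 0 xpredT add_continuous) => // j _.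
  by apply: cvgM; [exact: cvg_cst|exact: coordC].
have Pc : compact P.
  apply: compact_closedI.
    apply: compact_setX; last exact: segment_compact.
    exact: (@rV_compact R lam (fun=> `[0, 1]%classic) (fun=> @segment_compact R 0 1)).
  apply: closedI.
    apply: closed_bigI => i _; apply: preimage_closed; last exact: closed_le.
    by move=> z _; apply: gC.
  by apply: preimage_closed; [move=> z _; apply: hC | exact: closed_eq].
have lam0 : (0 < lam)%N by apply: leq_ltn_trans (ltn_ord i0).
have P0 : P !=set0.
  exists (\row_j (j == i0)%:R, 0); split; first split => /=.
  - move=> i; rewrite /= in_itv /= mxE.
    by case: (i == i0); rewrite /= ?lexx ?ler01.
  - by rewrite in_itv /= lexx B0.
  split.
    move=> i _; rewrite /g /= mul0r sub0r oppr_le0; apply: sumr_ge0 => j _.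
    by rewrite mulr_ge0 // mxE.
  rewrite /h /= (bigD1 i0) //= big1 => [|j ji]; rewrite mxE ?eqxx ?addr0 //.
  by rewrite (negbTE ji).
have [|[u r] uP rmax] := @compact_EVT_max _ R snd P P0 Pc.
  by apply: continuous_subspaceT => z; apply: cvg_snd.
move: uP; rewrite inE => -[[uK rB] [ug uh]].
move: rB; rewrite /= in_itv /= => /andP[r0 rB].
have u0 i : 0 <= u ord0 i by have := uK i; rewrite /= in_itv /= => /andP[].
exists r, (u ord0); split => //.
- apply/not_existsP => H; move: uh; rewrite /h /= big1 => [/eqP|j _].
    by rewrite eq_sym oner_eq0.
  by apply/eqP; rewrite eq_le u0 andbT leNgt; apply/negP/H.
- by move=> i; have := ug i I; rewrite /g /= subr_le0.
move=> s v v0 vj Av; have sb := sB s v v0 vj Av.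
have [s0|s0] := leP 0 s; last by apply: ltW (lt_le_trans s0 r0).
pose c := \sum_j v j.
have c0 : 0 < c.
  case: vj => j vj; rewrite /c (bigD1 j) //= ltr_wpDr //.
  by apply: sumr_ge0.
have vc i : v i <= c.
  by rewrite /c (bigD1 i) //= lerDl; apply: sumr_ge0.
apply: (rmax (\row_j (v j / c), s)); rewrite inE; split; first split => /=.
- move=> i; rewrite /= in_itv /= mxE divr_ge0 ?(ltW c0) //=.
  by rewrite ler_pdivrMr // mul1r.
- by rewrite in_itv /= s0 sb.
split.
  move=> i _; rewrite /g /= mxE subr_le0.
  under eq_bigr do rewrite mxE mulrA.
  by rewrite -mulr_suml mulrA ler_pM2r ?invr_gt0 //; apply: Av.
rewrite /h /=; under eq_bigr do rewrite mxE.
by rewrite -mulr_suml divff // gt_eqF.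
Qed.

(** If r u <= A u were strict in one row, the positive power A^k would spread the surplus to all
    rows of y = A^k u, and y would admit a factor larger than the maximal r. So u is an eigenvector,
    and y is a positive one. *)
Lemma perron_exists A (i0 : 'I_lam) : primitive_mx A ->
  exists (r : R) v, [/\ 0 <= r, forall i, 0 < v i & forall i, act A v i = r * v i].
Proof.
case=> k k0 Ak; have [r [u [r0 u0 [j uj] Au rmax]]] := max_subeigenvector A i0.
have y0 := iter_act_pos Ak u0 uj.
pose y := iter k (act A) u.
have d0 i : 0 <= act A u i - r * u i by rewrite subr_ge0.
have Ay i : act A y i - r * y i = iter k (act A) (fun i => act A u i - r * u i) i.
  by rewrite act_iterB iter_act_scale -iterSr.
have [[l dl]|H] := pselect (exists l, 0 < act A u l - r * u l); last first.
  have E i : act A u i = r * u i.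
    apply/eqP; rewrite -subr_eq0 eq_le d0 andbT leNgt; apply/negP => ?.
    by apply: H; exists i.
  exists r, y; split => // i; apply/eqP; rewrite -subr_eq0 Ay; apply/eqP.
  rewrite iter_act big1 // => l _; by rewrite E subrr mulr0.
have Ay0 i : 0 < act A y i - r * y i by rewrite Ay; apply: iter_act_pos dl i.
case: (@Order.TotalTheory.arg_minP _ _ _ i0 xpredT (fun i => act A y i / y i)) => // m _ mmin.
have : act A y m / y m <= r.
  apply: (rmax _ y); first by move=> i; apply/ltW/y0.
    by exists i0; apply: y0.
  move=> i; rewrite -ler_pdivlMr ?y0 //; exact: mmin.
rewrite ler_pdivrMr ?y0 // => H; have := Ay0 m.
by rewrite subr_gt0 ltNge H.
Qed.

Section Eigenvalue.
Variables (F : fieldType) (n : nat).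

Lemma det0_right (B : 'M[F]_n) : \det B = 0 <->
  exists2 v : 'cV[F]_n, v != 0 & B *m v = 0.
Proof.
rewrite -det_tr; split=> [/eqP/det0P[v v0 vB]|[v v0 Bv]].
  exists v^T; first by rewrite -trmx0 (inj_eq trmx_inj).
  by apply: trmx_inj; rewrite trmx_mul trmxK vB trmx0.
apply/eqP/det0P; exists v^T; first by rewrite -trmx0 (inj_eq trmx_inj).
by rewrite -trmx_mul Bv trmx0.
Qed.

(** [eigenvalue] speaks of row vectors, whereas the Perron vector is a column; both conditions say
    that det (B - a) = 0. *)
Lemma eigenvalue_right (B : 'M[F]_n) a : eigenvalue B a <->
  exists2 v : 'cV[F]_n, v != 0 & B *m v = a *: v.
Proof.
have E : eigenvalue B a <-> \det (B - a%:M) = 0.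
  split=> [/eigenvalueP[v vB v0]|/eqP/det0P[v v0 vB]].
    apply/eqP/det0P; exists v => //.
    by rewrite mulmxBr vB mul_mx_scalar subrr.
  apply/eigenvalueP; exists v => //; apply/eqP.
  by rewrite -subr_eq0 -mul_mx_scalar -mulmxBr vB.
rewrite E det0_right; split=> -[v v0 H]; exists v => //.
  by apply/eqP; rewrite -subr_eq0 -mul_scalar_mx -mulmxBl H.
by rewrite mulmxBl H mul_scalar_mx subrr.
Qed.

End Eigenvalue.

(** For an eigenvalue z, the moduli u of the coordinates of an eigenvector satisfy |z| u <= A u, and
    comparison with the positive eigenvector v gives |z| <= r. *)
Lemma spectral_radiusE A (r : R) v (i0 : 'I_lam) : 0 <= r -> (forall i, 0 < v i) ->
  (forall i, act A v i = r * v i) -> spectral_radius R A = r.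
Proof.
move=> r0 v0 Av; rewrite /spectral_radius; set E := [set _ | _ in _].
have ubE : ubound E r.
  move=> _ [z /= /eigenvalue_right[x x0 Ax] <-].
  have [j xj] : exists j, x j 0 != 0.
    apply/not_existsP => H; move/eqP: x0; apply; apply/matrixP => i k.
    by rewrite ord1 mxE; apply/eqP/negPn/negP/H.
  pose u i := Normc.normc (x i 0).
  have nE (z' : complex R) : (Normc.normc z')%:C%C = `|z'| by [].
  have u0 i : 0 <= u i by rewrite /u; case: (x i 0) => a b; apply: sqrtr_ge0.
  apply: (@cw_le A u v _ r j) => //.
  - by move=> i; rewrite Av.
  - by rewrite lt0r u0 andbT; apply: contraNneq xj => /Normc.eq0_normc ->.
  move=> i; have := congr1 (fun M : 'cV_lam => M i 0) Ax; rewrite !mxE => Ei.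
  rewrite -Normc.normcM -Ei -lecR nE.
  apply: le_trans (ler_norm_sum _ _ _) _.
  rewrite /act rmorph_sum /=; apply: ler_sum => l _.
  by rewrite mxE normrM normr_nat rmorphM /= rmorph_nat.
have rE : E r.
  exists (r%:C)%C; last by rewrite /Normc.normc /= expr0n addr0 sqrtr_sqr ger0_norm.
  apply/eigenvalue_right; exists (\col_i ((v i)%:C)%C).
    apply/eqP => /matrixP/(_ i0 0); rewrite !mxE => /eqP.
    by rewrite eq_complex /= gt_eqF.
  apply/matrixP => i k; rewrite !mxE -rmorphM /= -Av rmorph_sum /=.
  by apply: eq_bigr => j _; rewrite !mxE rmorphM /= rmorph_nat.
apply/eqP; rewrite eq_le; apply/andP; split.
  by apply: sup_le_ub => //; exists r.
by apply: sup_upper_bound => //; split; exists r.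
Qed.

Lemma perron A (i0 : 'I_lam) : primitive_mx A -> exists v,
  (forall i, 0 < v i) /\ (forall i, act A v i = spectral_radius R A * v i).
Proof.
move=> Ap; have [r [v [r0 v0 Av]]] := perron_exists i0 Ap.
by exists v; rewrite (spectral_radiusE i0 r0 v0 Av).
Qed.

Lemma spectral_radius_ge A (i0 : 'I_lam) (c : R) : primitive_mx A ->
  (forall i, c <= act A (fun=> 1) i) -> c <= spectral_radius R A.
Proof.
move=> Ap cA; have [v [v0 Av]] := perron i0 Ap.
apply: (@cw_le A (fun=> 1) v _ _ i0) => //.
  by move=> i; rewrite Av.
by move=> i; rewrite mulr1.
Qed.

(** An inequality that is strict in one row for y is strict in every row for z = A^k y, and the
    comparison made with z is then strict. *)
Lemma spectral_radius_lt A (i0 : 'I_lam) y (t : R) : primitive_mx A ->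
  (forall i, 0 < y i) -> (forall i, act A y i <= t * y i) ->
  (exists i, act A y i < t * y i) -> spectral_radius R A < t.
Proof.
move=> Ap y0 Ay [j Aj]; have [u [u0 Au]] := perron i0 Ap.
case: Ap => k k0 Ak; pose z := iter k (act A) y.
have z0 : forall i, 0 < z i.
  by apply: (iter_act_pos (j := i0) Ak) => // i; apply: ltW.
apply: (@cw_lt A u z _ _ i0) => //; last 2 first.
- by move=> i; apply: ltW.
- by move=> i; rewrite Au.
move=> i; rewrite -subr_gt0.
have -> : t * z i - act A z i = iter k (act A) (fun i => t * y i - act A y i) i.
  by rewrite act_iterB iter_act_scale -iterSr.
apply: (iter_act_pos (j := j)) => //; last by rewrite subr_gt0.
by move=> l; rewrite subr_ge0.
Qed.

End Perron.

(** * The minimal spectral radius *)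

Section Selections.
Variables (R : realType) (lam : nat) (S : igs lam).
Hypothesis wfS : wf_igs S.
Hypothesis primS : primitive_igs S.
Implicit Types (w : 'I_lam -> R).

Lemma some_color : exists i : 'I_lam, True.
Proof. by case: wfS => _ /card_gt0P[e _] _ _; exists (color _ e). Qed.

Lemma cost_chi (G : cgraph lam) w (p : seq (garc G * gnode G)) :
  \sum_j (chi_path p 0 j)%:R * w j = cost w p.
Proof.
elim: p => [|[e y] p IH].
  by rewrite /cost big_nil big1 // => j _; rewrite mxE mul0r.
rewrite /cost big_cons -[X in _ = _ + X]IH.
rewrite -[w (color G e)]mul1r (_ : 1 * _ = \sum_j (color G e == j)%:R * w j).
  rewrite -big_split /=; apply: eq_bigr => j _.
  by rewrite !mxE /= natrD mulrDl.
rewrite (bigD1 (color G e)) //= eqxx big1 ?addr0 // => j jc.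
by rewrite eq_sym (negbTE jc) mul0r.
Qed.

Lemma Dset_row D i : Dset S D -> exists p,
  simple_path_between (nodeA (rules S i)) (nodeB (rules S i)) p /\
  forall w, act D w i = cost w p.
Proof.
move=> /(_ i)[p pP E]; exists p; split=> // w.
rewrite -cost_chi; apply: eq_bigr => j _; by rewrite E mxE.
Qed.

Lemma Dset_of_paths (p : forall i, seq (garc (rules S i) * gnode (rules S i))) :
  (forall i, simple_path_between (nodeA (rules S i)) (nodeB (rules S i)) (p i)) ->
  exists2 D, Dset S D & forall w i, act D w i = cost w (p i).
Proof.
move=> pP; exists (\matrix_(i, j) chi_path (p i) 0 j).
  by move=> i; exists (p i); [exact: pP | apply/rowP => j; rewrite !mxE].
move=> w i; rewrite -cost_chi; apply: eq_bigr => j _; by rewrite !mxE.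
Qed.

Lemma sub_weight_le D w : Dset S D -> (forall i, 0 <= w i) ->
  forall i, sub_weight S w i <= act D w i.
Proof.
move=> DS w0 i; have [p [/and3P[pw /eqP pB _] ->]] := Dset_row i DS.
by rewrite /sub_weight -pB; apply: wdist_le.
Qed.

Lemma sub_weight_attained w : (forall i, 0 <= w i) ->
  exists2 D, Dset S D & forall i, sub_weight S w i = act D w i.
Proof.
move=> w0.
have pP i := cid (@wdist_attained R lam _ w (nodeA (rules S i)) (nodeB (rules S i))
  (rule_connected wfS (i := i)) w0).
have [D DS DE] := Dset_of_paths (fun i => (svalP (pP i)).1).
by exists D => // i; rewrite DE (svalP (pP i)).2.
Qed.

Lemma Dset_entry_bound D i j : Dset S D ->
  (D i j < (\max_i #|gnode (rules S i)|).+1)%N.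
Proof.
move=> /(_ i)[p pP E].
have -> : D i j = chi_path p 0 j by rewrite E mxE.
rewrite mxE ltnS; apply: leq_trans (count_size _ _) _.
by apply: leq_trans (ltnW (simple_path_size pP)) _; apply: leq_bigmax.
Qed.

(** The entries of a selection count arcs of simple paths, hence are bounded; the selections are
    images of a finite type, and the infimum is attained. *)
Lemma rho_min_attained : exists2 D, Dset S D &
  spectral_radius R D = rho_min R S /\
  forall D', Dset S D' -> rho_min R S <= spectral_radius R D'.
Proof.
have [D0 D0S _] := sub_weight_attained (fun=> ler01).
pose B := (\max_i #|gnode (rules S i)|)%N.
pose T : Type := 'M['I_B.+1]_lam.
pose m (t : T) : 'M[nat]_lam := map_mx val t.
have mE D : Dset S D -> exists t : T, m t = D.
  move=> DS; exists (\matrix_(i, j) Ordinal (Dset_entry_bound i j DS)).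
  by apply/matrixP => i j; rewrite !mxE.
have [t0 t0E] := mE _ D0S.
have P0 : `[< Dset S (m t0) >] by apply/asboolP; rewrite t0E.
case: (@Order.TotalTheory.arg_minP _ _ _ t0 (fun t => `[< Dset S (m t) >])
  (fun t => spectral_radius R (m t)) P0) => t /asboolP tS tmin.
have H D' : Dset S D' -> spectral_radius R (m t) <= spectral_radius R D'.
  by move=> D'S; have [t' t'E] := mE _ D'S; rewrite -t'E; apply: tmin;
    apply/asboolP; rewrite t'E.
have E : spectral_radius R (m t) = rho_min R S.
  apply/eqP; rewrite eq_le; apply/andP; split.
    apply: lb_le_inf; first by exists (spectral_radius R (m t)); exists (m t).
    by move=> _ [D' D'S <-]; apply: H.
  apply: ge_inf; last by exists (m t).
  by exists (spectral_radius R (m t)) => _ [D' D'S <-]; apply: H.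
by exists (m t) => //; split=> // D' /H; rewrite E.
Qed.

(* If the minimizer D of the spectral radius were not row-wise optimal for its
   Perron vector v, the row-wise optimal selection would have a smaller
   spectral radius. *)
Lemma rho_min_eigenvector : exists D v,
  [/\ Dset S D, forall i, 0 < v i, forall i, act D v i = rho_min R S * v i &
      forall i, sub_weight S v i = rho_min R S * v i].
Proof.
have [i0 _] := some_color.
have [D DS [Drho Dmin]] := rho_min_attained.
have [v [v0 Dv]] := @perron R lam D i0 (primS.2 _ DS); rewrite Drho in Dv.
exists D, v; split => // i.
have v0' j : 0 <= v j by apply: ltW.
have [D' D'S D'v] := sub_weight_attained v0'.
have le j : act D' v j <= rho_min R S * v j.
  by rewrite -D'v -Dv; apply: sub_weight_le.
apply/eqP; rewrite D'v eq_le le /= leNgt; apply/negP => lt.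
have := spectral_radius_lt i0 (primS.2 _ D'S) v0 le (ex_intro _ i lt).
by rewrite ltNge Dmin.
Qed.

Lemma path_size_ge2 i p :
  simple_path_between (nodeA (rules S i)) (nodeB (rules S i)) p -> (2 <= size p)%N.
Proof.
case/and3P => pw /eqP pB _; case: wfS => _ _ _ /(_ i) dAB.
apply: leq_trans dAB _; rewrite -(ler_nat R).
rewrite (gdist_wdist R _ _ (rule_connected wfS (i := i))).
rewrite -pB; apply: le_trans (@wdist_le R lam _ (fun=> 1) _ _ (fun=> ler01) pw) _.
by rewrite /cost big_const_seq count_predT iter_addr_0.
Qed.

Lemma rho_min_ge2 : 2 <= rho_min R S.
Proof.
have [i0 _] := some_color.
have [D DS [<- _]] := rho_min_attained.
apply: (spectral_radius_ge i0 (primS.2 _ DS)) => i.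
have [p [/path_size_ge2 p2 ->]] := Dset_row i DS.
by rewrite /cost big_const_seq count_predT iter_addr_0 ler_nat.
Qed.

Lemma act_Mmx w i : act (Mmx S) w i = \sum_(a : garc (rules S i)) w (color _ a).
Proof.
rewrite (partition_big (color (rules S i)) xpredT) //=; apply: eq_bigr => j _.
rewrite (eq_bigr (fun=> w j)) => [|a /eqP -> //].
rewrite !mxE sumr_const mulr_natl; congr (_ *+ _).
by apply: eq_card => a; rewrite !inE.
Qed.

Lemma rule_arcs_ge2 i : (2 <= #|garc (rules S i)|)%N.
Proof.
have [p pP] := ex_simple_path R (nodeA (rules S i)) (nodeB (rules S i))
  (rule_connected wfS (i := i)).
have := path_size_ge2 pP.
case: p pP => [|[e y] [|[e' z] p]] //= /and3P[/= /and3P[ey e'z _] _ u] _.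
have ee' : e != e'.
  apply: contraTneq u => eE; rewrite -eE in e'z.
  suff : (nodeA (rules S i) == y) || (nodeA (rules S i) == z).
    by rewrite !inE; case/orP => ->; rewrite ?orbT.
  have [] := joins_ends ey => -[E1 E2]; have [] := joins_ends e'z => -[E3 E4].
  - by rewrite -E1 -E3 eqxx.
  - by rewrite -E1 -E3 eqxx orbT.
  - by rewrite -E2 -E4 eqxx orbT.
  - by rewrite -E2 -E4 eqxx.
have := max_card (mem [set e; e']%SET); rewrite cards2 ee'.
by [].
Qed.

Lemma spectral_radius_M_ge2 : 2 <= spectral_radius R (Mmx S).
Proof.
have [i0 _] := some_color.
apply: (spectral_radius_ge i0 primS.1) => i.
by rewrite act_Mmx sumr_const ler_nat rule_arcs_ge2.
Qed.

End Selections.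

(** * Growth of the distances between the ends of an arc *)

Lemma finite_argmin (R : realType) (I : finType) (i0 : I) (f : I -> R) :
  exists m, forall i, f m <= f i.
Proof.
case: (@Order.TotalTheory.arg_minP _ _ _ i0 xpredT f) => // m _ mmin.
by exists m => i; apply: mmin.
Qed.

Lemma finite_argmax (R : realType) (I : finType) (i0 : I) (f : I -> R) :
  exists m, forall i, f i <= f m.
Proof.
case: (@Order.TotalTheory.arg_maxP _ _ _ i0 xpredT f) => // m _ mmax.
by exists m => i; apply: mmax.
Qed.

Lemma cvg_of_tails (R : realType) (u : R^nat) :
  (forall e, 0 < e -> exists l N, forall n, (N <= n)%N -> `|u n - l| < e) -> cvgn u.
Proof.
move=> H; apply: cauchy_cvg; apply: cauchy_exP => e e0.
have [l [N Hl]] := H e e0; exists l.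
by exists N => // n /= Nn; rewrite /ball /= distrC; apply: Hl.
Qed.

Section Growth.
Variables (R : realType) (lam : nat) (S : igs lam).
Hypothesis wfS : wf_igs S.
Hypothesis primS : primitive_igs S.
Implicit Types (w : 'I_lam -> R).
Local Notation rho := (rho_min R S).
Local Notation F := (@sub_weight R lam S).

Lemma rho_min_gt0 : 0 < rho.
Proof. by apply: lt_le_trans (rho_min_ge2 R wfS primS). Qed.

Lemma rho_min_expr_gt0 n : 0 < rho ^+ n.
Proof. by rewrite exprn_gt0 // rho_min_gt0. Qed.

Lemma iter_sub_weight_ge0 n w : (forall i, 0 <= w i) -> forall i, 0 <= iter n F w i.
Proof. by move=> w0; elim: n => [|n IH] i //=; apply: sub_weight_ge0. Qed.

(** As the fixed selection D bounds F from above only, the contraction lowers the maximal ratio b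
    towards the minimal ratio a and never raises a. Since both are monotone and bounded, this forces
    their limits to agree. *)
Lemma iter_sub_weight_cvg D v w : Dset S D -> (forall i, 0 < v i) ->
  (forall i, act D v i = rho * v i) -> (forall i, F v i = rho * v i) ->
  (forall i, 0 < w i) ->
  exists2 L : R, 0 < L & forall i, (iter n F w i / rho ^+ n) @[n --> \oo] --> L * v i.
Proof.
move=> DS v0 Dv Fv w0; have [i0 _] := some_color wfS.
have rn0 := rho_min_expr_gt0.
have v0' i : 0 <= v i by apply: ltW.
have w0' i : 0 <= w i by apply: ltW.
pose x n := iter n F w.
have x0 n i : 0 <= x n i by apply: iter_sub_weight_ge0.
pose y n i := x n i / (rho ^+ n * v i).
have yE n i : x n i = y n i * rho ^+ n * v i.
  by rewrite /y -mulrA divfK // mulf_neq0 // gt_eqF.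
pose mn n := sval (cid (finite_argmin i0 (y n))).
pose mx n := sval (cid (finite_argmax i0 (y n))).
pose a n := y n (mn n); pose b n := y n (mx n).
have ay n i : a n <= y n i by exact: (svalP (cid (finite_argmin i0 (y n)))).
have yb n i : y n i <= b n by exact: (svalP (cid (finite_argmax i0 (y n)))).
have y0 n i : 0 <= y n i.
  by rewrite /y divr_ge0 // ltW // mulr_gt0.
have a0 n : 0 <= a n * rho ^+ n by rewrite mulr_ge0 ?(ltW (rn0 n)) ?y0.
have b0 n : 0 <= b n * rho ^+ n by rewrite mulr_ge0 ?(ltW (rn0 n)) ?y0.
have stepE c i : 0 <= c -> F (fun j => c * v j) i = c * (rho * v i).
  by move=> c0; rewrite sub_weight_scale // Fv.
have aS n i : a n <= y n.+1 i.
  rewrite /y ler_pdivlMr ?mulr_gt0 //.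
  have -> : a n * (rho ^+ n.+1 * v i) = F (fun j => (a n * rho ^+ n) * v j) i.
    by rewrite stepE // exprSr !mulrA.
  apply: sub_weight_mono => //.
    by move=> j; rewrite mulr_ge0.
  by move=> j; rewrite [leRHS]yE; rewrite !ler_pM2r.
have bS n i : y n.+1 i <= b n.
  rewrite /y ler_pdivrMr ?mulr_gt0 //.
  have -> : b n * (rho ^+ n.+1 * v i) = F (fun j => (b n * rho ^+ n) * v j) i.
    by rewrite stepE // exprSr !mulrA.
  apply: sub_weight_mono => // j.
  by rewrite [leLHS]yE; rewrite !ler_pM2r.
case: (primS.2 _ DS) => k k0 Dk.
have xD n i : x (k + n)%N i <= iter k (act D) (x n) i.
  elim: (k) i => [|l IH] i //=.
  apply: le_trans (act_mono D IH i).
  by apply: sub_weight_le => // j; apply: x0.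
have [lo lov] := finite_argmin i0 v.
have [hi vhi] := finite_argmax i0 v.
(* Chosen so that c rho^k v i <= v lo for all i; the entries of D^k are at least 1. *)
pose c := v lo / (rho ^+ k * v hi).
have c0 : 0 < c by rewrite divr_gt0 // mulr_gt0.
have contract n i : y (k + n)%N i <= b n - c * (b n - a n).
  have ba : 0 <= b n - a n by rewrite subr_ge0; apply: le_trans (ay n i0) (yb n i0).
  rewrite /y ler_pdivrMr ?mulr_gt0 //; apply: le_trans (xD n i) _.
  (* Of the sum over columns only the term [mn n] is kept, where the ratio falls short of b by the
     full gap b - a. *)
  have H : (b n - a n) * rho ^+ n * v (mn n) <=
      iter k (act D) (fun j => (b n * rho ^+ n) * v j - x n j) i.
    rewrite iter_act (bigD1 (mn n)) //= -[leLHS]addr0; apply: lerD.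
      rewrite yE -/(a n) -!mulrBl ler_peMl ?ler1n //.
      by rewrite !mulr_ge0 // ltW.
    apply: sumr_ge0 => j _; apply: mulr_ge0 => //.
    by rewrite yE subr_ge0 !ler_pM2r.
  move: H; rewrite act_iterB iter_act_scale (iter_act_eigen k Dv).
  move=> H.
  have H2 : (b n - a n) * rho ^+ n * (c * (rho ^+ k * v i)) <=
      (b n - a n) * rho ^+ n * v (mn n).
    apply: ler_wpM2l; first by rewrite mulr_ge0 // ltW.
    apply: le_trans (lov (mn n)).
    rewrite /c mulrAC ler_pdivrMr ?mulr_gt0 // ler_pM2l //.
    by rewrite ler_pM2l.
  rewrite exprD.
  have -> : (b n - c * (b n - a n)) * (rho ^+ k * rho ^+ n * v i) =
     b n * rho ^+ n * (rho ^+ k * v i) -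
     (b n - a n) * rho ^+ n * (c * (rho ^+ k * v i)) by ring.
  rewrite lerBrDr; apply: le_trans (lerD (lexx _) H2) _.
  by rewrite -lerBrDl addrC -lerBlDr opprK addrC -lerBrDr.
have a_nd : nondecreasing_seq a by apply/nondecreasing_seqP => n; apply: aS.
have b_ni : nonincreasing_seq b by apply/nonincreasing_seqP => n; apply: bS.
have ab n : a n <= b n by apply: le_trans (ay n i0) (yb n i0).
have ac : cvgn a.
  apply: nondecreasing_is_cvgn => //; exists (b 0%N) => _ [n _ <-].
  by apply: le_trans (ab n) (b_ni _ _ (leq0n n)).
have bc : cvgn b.
  apply: nonincreasing_is_cvgn => //; exists (a 0%N) => _ [n _ <-].
  by apply: le_trans (a_nd _ _ (leq0n n)) (ab n).
have lim_le : limn b <= limn b - c * (limn b - limn a).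
  have H : (fun n => b n - c * (b n - a n)) @ \oo --> limn b - c * (limn b - limn a).
    by apply: cvgB => //; apply: cvgM; [exact: cvg_cst | apply: cvgB].
  apply: (@ler_cvg_to _ _ _ _ (fun n => b (n + k)%N) _ _ _ _ H).
    by rewrite (cvg_shiftn k b).
  by apply: nearW => n; rewrite addnC; apply: contract.
have ab_lim : limn a = limn b.
  apply/eqP; rewrite eq_le; apply/andP; split.
    by apply: ler_lim => //; apply: nearW.
  by move: lim_le; rewrite -[leLHS]addr0 lerD2l oppr_ge0 pmulr_rle0 // subr_le0.
exists (limn a).
  (* The ratio a is nondecreasing and starts positive because w is. *)
  apply: lt_le_trans (nondecreasing_cvgn_le a_nd ac 0%N).
  by rewrite /a /y /x /= expr0 mul1r divr_gt0.
move=> i.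
have yc : y n i @[n --> \oo] --> limn a.
  apply: (@squeeze_cvgr _ _ _ _ a b) => //; last by rewrite ab_lim.
  by apply: nearW => n; rewrite ay yb.
rewrite (_ : (fun n => _) = (fun n => y n i * v i)).
  by apply: cvgM yc _; apply: cvg_cst.
apply/funext => n; rewrite -/(x n) yE mulrAC mulfK //.
by rewrite gt_eqF.
Qed.

End Growth.

(** * The limit metric on nodes *)

Section Levels.
Variables (lam : nat) (S : igs lam).

(** The inclusion of V(Xi m) in V(Xi (r + m)). The sum computes on [r], so that no transport between
    equal levels is needed. *)
Fixpoint lift_node r m (u : gnode (Xi S m)) : gnode (Xi S (r + m)) :=
  match r return gnode (Xi S (r + m)) with
  | 0 => u
  | r'.+1 => (inl (lift_node r' u) : gnode (subst_graph S (Xi S (r' + m))))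
  end.

Lemma to_lnode_lift r m (u : gnode (Xi S m)) :
  to_lnode (lift_node r u) = to_lnode u.
Proof. by elim: r. Qed.

Lemma to_lnode_birth n (u : gnode (Xi S n)) z :
  to_lnode u = inr z -> (tag z < n)%N.
Proof.
elim: n u => [|n IH] //= [u /IH|x [<-]]; [exact: ltnW | exact: ltnSn].
Qed.

Lemma to_lnode_inj n : injective (@to_lnode lam S n).
Proof.
elim: n => [|n IH] x y; first by move=> /= [].
case: x y => [x|x] [y|y] //=.
- by move=> /IH ->.
- by move=> /to_lnode_birth; rewrite ltnn.
- by move=> /esym/to_lnode_birth; rewrite ltnn.
case=> /eqP.
by rewrite (@eq_Tagged nat (fun m => new_node S (Xi S m)) (existT _ n x) y) => /eqP /= ->.
Qed.

Lemma to_lnode_surj (x : lnode S) : exists N, forall n, (N <= n)%N ->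
  exists u, @to_lnode lam S n u = x.
Proof.
have lift N u n : (N <= n)%N -> @to_lnode lam S N u = x ->
    exists u, @to_lnode lam S n u = x.
  move=> Nn ux; rewrite -(subnK Nn); exists (lift_node (n - N) u).
  by rewrite to_lnode_lift.
case: x lift => [u|[k w]] lift.
  by exists 0%N => n /lift; apply; apply: (erefl : @to_lnode lam S 0 u = inl u).
exists k.+1 => n /lift; apply.
by apply: (erefl : @to_lnode lam S k.+1 (inr w) = _).
Qed.

Lemma level_distE n (u v : gnode (Xi S n)) :
  level_dist n (to_lnode u) (to_lnode v) = gdist u v.
Proof.
rewrite /level_dist; case: pickP => [[p q] /= /andP[/eqP pu /eqP qv]|/(_ (u, v))].
  by rewrite (to_lnode_inj pu) (to_lnode_inj qv).
by rewrite /= !eqxx.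
Qed.

End Levels.

Section Continuity.
Variables (R : realType) (lam : nat) (G : cgraph lam).
Hypothesis Gc : connected_graph G.

(** A simple path that is optimal for one weight is nearly optimal for the other: it has fewer arcs
    than [G] has nodes, and each costs at most [d] more. *)
Lemma wdist_perturb (w w' : 'I_lam -> R) (d : R) (x y : gnode G) :
  (forall i, 0 <= w i) -> (forall i, 0 <= w' i) -> 0 <= d ->
  (forall i, `|w i - w' i| <= d) ->
  `|wdist w x y - wdist w' x y| <= d *+ #|gnode G|.
Proof.
move=> w0 w'0 d0 ww'.
have H (u u' : 'I_lam -> R) : (forall i, 0 <= u i) -> (forall i, 0 <= u' i) ->
    (forall i, u i <= u' i + d) -> wdist u x y <= wdist u' x y + d *+ #|gnode G|.
  move=> u0 u'0 uu'; have [p [pP <-]] := wdist_attained x y Gc u'0.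
  have pN := simple_path_size pP; case/and3P: pP => pw /eqP <- _.
  apply: le_trans (wdist_le u0 pw) _.
  apply: (@le_trans _ _ (cost u' p + d *+ size p)); last first.
    by rewrite lerD2l; apply: ler_wpMn2l => //; apply: ltnW.
  elim: (p) => [|s q IH]; first by rewrite /cost !big_nil addr0.
  rewrite /cost !big_cons /= mulrS addrACA; apply: lerD => //.
have le1 i : w i <= w' i + d.
  by have := ww' i; rewrite ler_distl => /andP[].
have le2 i : w' i <= w i + d.
  by have := ww' i; rewrite ler_distl lerBlDr => /andP[].
rewrite ler_distl lerBlDr; apply/andP; split; exact: H.
Qed.

End Continuity.

Section Metric.
Variables (R : realType) (lam : nat) (S : igs lam).
Hypothesis wfS : wf_igs S.
Hypothesis primS : primitive_igs S.
Implicit Types (w : 'I_lam -> R).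
Local Notation rho := (rho_min R S).
Local Notation F := (@sub_weight R lam S).

Let rho0 := rho_min_gt0 R wfS primS.
Let rn0 := rho_min_expr_gt0 R wfS primS.
Let Xc n : connected_graph (Xi S n) := @Xi_connected lam S wfS n.
Arguments Xc : clear implicits.

Lemma wdist_lift w r m (u u' : gnode (Xi S m)) : (forall i, 0 <= w i) ->
  wdist w (lift_node r u) (lift_node r u') = wdist (iter r F w) u u'.
Proof.
elim: r w => [|r IH] w w0 //=.
rewrite wdist_subst //.
by rewrite IH -?iterSr // => i; apply: sub_weight_ge0.
Qed.

Lemma rule_diam_bounded : exists2 K : nat, (0 < K)%N &
  forall i, (#|gnode (rules S i)| <= K)%N.
Proof.
exists (\max_i #|gnode (rules S i)|).+1 => // i.
by apply: leqW; apply: leq_bigmax.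
Qed.

Section Eigenvector.
Variable v : 'I_lam -> R.
Hypothesis v0 : forall i, 0 < v i.
Hypothesis Fv : forall i, F v i = rho * v i.

Let v0' i : 0 <= v i. Proof. exact: ltW. Qed.

Lemma iter_sub_weight_eigen r : iter r F v = (fun i => rho ^+ r * v i).
Proof.
elim: r => [|r IH] /=; first by apply/funext => i; rewrite expr0 mul1r.
rewrite IH sub_weight_scale // ?(ltW (rn0 r)) //.
by apply/funext => i; rewrite Fv exprSr mulrA.
Qed.

Lemma place_near : exists2 K : R, 0 < K & forall n (e : garc (Xi S n)) u,
  wdist v (@place lam S (Xi S n) e u : gnode (Xi S n.+1)) (inl (abeg (Xi S n) e)) <= K.
Proof.
have [i0 _] := some_color wfS; have [hi vhi] := finite_argmax i0 v.
have [K K0 RK] := rule_diam_bounded.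
exists (v hi *+ K); first by rewrite pmulrn_rgt0.
move=> n e u; rewrite -(@placeA lam S).
apply: (@le_trans _ _ (v hi *+ #|gnode (rules S (color (Xi S n) e))|)); last first.
  by apply: ler_wpMn2l.
apply: le_trans (_ : wdist v u (nodeA _) <= _); last first.
  by apply: wdist_bounded => //; apply: rule_connected.
apply: (wdist_map (h := @place lam S (Xi S n) e) (G' := Xi S n.+1)) => //.
- exact: rule_connected.
- move=> a; pose a' : garc (Xi S n.+1) := existT _ e a.
  have := @wdist_step R lam (Xi S n.+1) v (Xc n.+1) v0' _ _ _ a' (joins_beg_end a').
  by move=> /(_ (abeg (Xi S n.+1) a')); rewrite wdistxx // add0r.
Qed.

Lemma node_near : exists2 K : R, 0 < K & forall n (u : gnode (Xi S n.+1)),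
  exists u' : gnode (Xi S n), wdist v u (inl u' : gnode (Xi S n.+1)) <= K.
Proof.
have [K K0 pK] := place_near; exists K => // n [u|[e u]].
  by exists u; rewrite wdistxx // ltW.
by exists (abeg (Xi S n) e); rewrite -place_inner.
Qed.

(* The geometric sum of the errors made at each level, where rho >= 2. *)
Lemma geometric_error (K : R) r : 0 <= K ->
  K + rho * (K * (rho ^+ r - 1)) <= K * (rho ^+ r.+1 - 1).
Proof.
move=> K0; have r2 := rho_min_ge2 R wfS primS; rewrite exprS.
have : 0 <= K * (rho - 2) by rewrite mulr_ge0 // subr_ge0.
lra.
Qed.

Lemma lift_near : exists2 K : R, 0 < K & forall r m (u : gnode (Xi S (r + m))),
  exists u' : gnode (Xi S m), wdist v u (lift_node r u') <= K * rho ^+ r.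
Proof.
have [K K0 nK] := node_near; exists K => // r m u.
(* Subtracting 1 strengthens the claim, so that the induction can absorb the error K of each
   level. *)
suff [u' H] : exists u', wdist v u (lift_node r u') <= K * (rho ^+ r - 1).
  by exists u'; apply: le_trans H _; rewrite ler_pM2l // lerBlDr lerDl.
elim: r u => [|r IH] u.
  by exists u; rewrite expr0 subrr mulr0 wdistxx.
have [u1 H1] := nK _ u; have [u' H'] := IH u1; exists u'.
apply: le_trans (wdist_triangle (Xc _) v0' (inl u1 : gnode (Xi S (r + m).+1)) _ _) _.
apply: le_trans _ (geometric_error r (ltW K0)); apply: lerD => //.
rewrite /= wdist_subst //.
rewrite (_ : F v = (fun i => rho * v i)); last exact/funext.
by rewrite (@wdist_scale R lam _ v _ _ _ (Xc _) (ltW rho0) v0') ler_pM2l.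
Qed.

Fixpoint arc_anc r m : garc (Xi S (r + m)) -> garc (Xi S m) :=
  match r return garc (Xi S (r + m)) -> garc (Xi S m) with
  | 0 => id
  | r'.+1 => fun a => arc_anc (tag (a : sub_arc S (Xi S (r' + m))))
  end.

Lemma anc_near : exists2 K : R, 0 < K & forall r m (a : garc (Xi S (r + m))),
  wdist v (abeg _ a) (lift_node r (abeg _ (arc_anc a))) <= K * rho ^+ r.
Proof.
have [K K0 pK] := place_near; exists K => // r m a.
suff H : wdist v (abeg _ a) (lift_node r (abeg _ (arc_anc a))) <= K * (rho ^+ r - 1).
  by apply: le_trans H _; rewrite ler_pM2l // lerBlDr lerDl.
elim: r a => [|r IH] a.
  by rewrite expr0 subrr mulr0 wdistxx.
case: a => e a.
apply: le_trans (wdist_triangle (Xc _) v0'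
  (inl (abeg _ e) : gnode (Xi S (r + m).+1)) _ _) _.
apply: le_trans _ (geometric_error r (ltW K0)); apply: lerD; first exact: pK.
rewrite /= wdist_subst //.
rewrite (_ : F v = (fun i => rho * v i)); last exact/funext.
by rewrite (@wdist_scale R lam _ v _ _ _ (Xc _) (ltW rho0) v0') ler_pM2l.
Qed.

End Eigenvector.

Lemma gdist_lift r m (u u' : gnode (Xi S m)) :
  (gdist (lift_node r u) (lift_node r u'))%:R = wdist (iter r F (fun=> 1)) u u' :> R.
Proof. by rewrite (gdist_wdist R _ _ (Xc _)) wdist_lift. Qed.

Lemma gdist_le_gdiam (G : cgraph lam) (x y : gnode G) : (gdist x y <= gdiam G)%N.
Proof.
rewrite /gdiam; apply: leq_trans (leq_bigmax x).
exact: (leq_bigmax (F := fun y => gdist x y)).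
Qed.

Lemma gdiam_attained (G : cgraph lam) : (0 < #|gnode G|)%N ->
  exists x y : gnode G, gdiam G = gdist x y.
Proof.
move=> G0; rewrite /gdiam.
have [x ->] := bigop.eq_bigmax (fun x : gnode G => \max_y gdist x y)%N G0.
by have [y ->] := bigop.eq_bigmax (fun y : gnode G => gdist x y) G0; exists x, y.
Qed.

Lemma start_ends : exists x y : gnode (start S), x != y.
Proof.
case: wfS => -[noloop _ _] /card_gt0P[e _] _ _.
by exists (abeg _ e), (aend _ e).
Qed.

Lemma Xi_node_gt0 n : (0 < #|gnode (Xi S n)|)%N.
Proof.
have [x _] := start_ends.
elim: n => [|n /card_gt0P[u _]]; apply/card_gt0P; first by exists x.
by exists (inl u).
Qed.

Lemma gdist_cvg (v : 'I_lam -> R) (L : R) : (forall i, 0 < v i) -> 0 < L ->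
  (forall i, (iter n F (fun=> 1) i / rho ^+ n) @[n --> \oo] --> L * v i) ->
  forall m (d : R), 0 < d -> exists N, forall r, (N <= r)%N ->
    forall u u' : gnode (Xi S m),
    `|(gdist (lift_node r u) (lift_node r u'))%:R / rho ^+ (r + m) -
      L * (wdist v u u' / rho ^+ m)| <= d.
Proof.
move=> v0 L0 ec m d d0.
have Lv0 i : 0 <= L * v i by rewrite mulr_ge0 ?ltW.
(* [wdist_perturb] loses a factor equal to the number of nodes. *)
pose d' := d * rho ^+ m / (#|gnode (Xi S m)|)%:R.
have N0 : 0 < (#|gnode (Xi S m)|)%:R :> R by rewrite ltr0n Xi_node_gt0.
have d'0 : 0 < d' by rewrite divr_gt0 // mulr_gt0.
have /filter_forall[N _ HN] : forall i,
    \forall n \near \oo, `|L * v i - iter n F (fun=> 1) i / rho ^+ n| <= d'.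
  by move=> i; apply: (@cvgr_dist_le _ _ _ _ _ _ _ (ec i)).
exists N => r Nr u u'; rewrite gdist_lift.
have el0 i : 0 <= iter r F (fun=> 1) i by apply: iter_sub_weight_ge0.
rewrite exprD invfM !mulrA -mulrBl normrM [X in _ * X]gtr0_norm ?invr_gt0 //.
rewrite ler_pdivrMr // [_ / _]mulrC.
have v0' i : 0 <= v i by apply: ltW.
rewrite -(@wdist_scale R lam _ v _ _ _ (Xc m) (ltW L0) v0').
have ir0 : 0 <= rho ^- r by rewrite invr_ge0 ltW.
rewrite -(@wdist_scale R lam _ _ _ _ _ (Xc m) ir0 el0).
apply: le_trans (wdist_perturb (d := d') _ _ _ _ _ _ _) _ => //.
- by move=> i; rewrite mulr_ge0 // invr_ge0 ltW.
- exact: ltW.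
- by move=> i; rewrite mulrC distrC; apply: HN.
by rewrite -[leLHS]mulr_natr /d' divfK // gt_eqF.
Qed.

Lemma rho_min_scale (c e : R) : 0 < c -> 0 < e -> exists m, c / rho ^+ m < e.
Proof.
move=> c0 e0; exists (Num.truncn (c / e)).+1.
rewrite ltr_pdivrMr // mulrC -ltr_pdivrMr //.
apply: lt_le_trans (truncnS_gt _) _.
apply: (@le_trans _ _ (2 ^+ (Num.truncn (c / e)).+1)).
  by rewrite -natrX ler_nat ltnW // ltn_expl.
by apply: lerXn2r; rewrite ?nnegrE ?(ltW rho0) // (rho_min_ge2 R wfS primS).
Qed.

(** The diameter may be realised by nodes born after level m, for which no uniform limit is at hand.
    But every node lies within C rho^r of V(Xi m), so that, divided by rho^(r + m) and up to an
    error 2 C / rho^m, the diameter is the largest distance in V(Xi m), which converges. *)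
Lemma gdiam_cvg (v : 'I_lam -> R) (L : R) : (forall i, 0 < v i) -> 0 < L ->
  (forall i, F v i = rho * v i) ->
  (forall i, (iter n F (fun=> 1) i / rho ^+ n) @[n --> \oo] --> L * v i) ->
  cvgn (fun n => (gdiam (Xi S n))%:R / rho ^+ n : R).
Proof.
move=> v0 L0 Fv ec; have v0' i : 0 <= v i by apply: ltW.
have [i0 _] := some_color wfS; have [lo vlo] := finite_argmin i0 v.
have [K K0 near] := lift_near v0 Fv.
have near1 r m (u : gnode (Xi S (r + m))) : exists u' : gnode (Xi S m),
    wdist (fun=> 1) u (lift_node r u') <= (K / v lo) * rho ^+ r.
  have [u' H] := near r m u; exists u'.
  rewrite mulrAC ler_pdivlMr // mulrC.
  rewrite -(@wdist_scale R lam _ (fun=> 1) _ _ _ (Xc _) (v0' lo)) //.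
  by apply: le_trans H; apply: wdist_mono => // i; rewrite mulr1.
set C := K / v lo in near1; have C0 : 0 < C by rewrite divr_gt0.
apply: cvg_of_tails => e e0.
have [m Hm] : exists m, C *+ 2 / rho ^+ m < e / 2.
  by apply: rho_min_scale; rewrite ?mulrn_wgt0 ?divr_gt0.
have Xi0 n : gnode (Xi S n) by apply: enum_val (Ordinal (Xi_node_gt0 n)).
have [[p q] pqmax] := finite_argmax
  ((Xi0 m, Xi0 m) : gnode (Xi S m) * gnode (Xi S m))
  (fun z => wdist v z.1 z.2).
have e4 : 0 < e / 4 by rewrite divr_gt0.
have [N HN] := gdist_cvg v0 L0 ec m e4.
exists (L * (wdist v p q / rho ^+ m)), (N + m)%N => n Nn.
have mn : (m <= n)%N by apply: leq_trans Nn; apply: leq_addl.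
have Nr : (N <= n - m)%N by rewrite leq_subRL // addnC.
rewrite -(subnK mn); move: (n - m)%N Nr => {n mn Nn} r Nr.
have rrm := rn0 (r + m).
apply: (@le_lt_trans _ _ (C *+ 2 / rho ^+ m + e / 4)); last by lra.
rewrite ler_distl; apply/andP; split.
  have := HN r Nr p q; rewrite ler_distl => /andP[H _].
  have H2 : (gdist (lift_node r p) (lift_node r q))%:R / rho ^+ (r + m) <=
      (gdiam (Xi S (r + m)))%:R / rho ^+ (r + m).
    by rewrite ler_pM2r ?invr_gt0 // ler_nat gdist_le_gdiam.
  have : 0 <= C *+ 2 / rho ^+ m by rewrite divr_ge0 ?mulrn_wge0 ?ltW.
  by move: H H2; lra.
have [a [b ->]] := gdiam_attained (Xi_node_gt0 (r + m)).
have [a' Ha] := near1 r m a; have [b' Hb] := near1 r m b.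
have := HN r Nr a' b'; rewrite ler_distl => /andP[_ H].
have H1 : L * (wdist v a' b' / rho ^+ m) <= L * (wdist v p q / rho ^+ m).
  by rewrite ler_pM2l // ler_pM2r ?invr_gt0 //; apply: (pqmax (a', b')).
apply: (@le_trans _ _ (C *+ 2 / rho ^+ m +
    (gdist (lift_node r a') (lift_node r b'))%:R / rho ^+ (r + m))); last first.
  by move: H H1; lra.
rewrite ler_pdivrMr // mulrDl divfK ?gt_eqF //.
have -> : C *+ 2 / rho ^+ m * rho ^+ (r + m) = C * rho ^+ r + C * rho ^+ r.
  by rewrite exprD [rho ^+ r * _]mulrC mulrA mulfVK ?gt_eqF // mulr2n mulrDl.
rewrite !(gdist_wdist R _ _ (Xc _)).
have o0 (i : 'I_lam) : 0 <= 1 :> R by [].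
apply: le_trans (wdist_triangle (Xc _) o0 (lift_node r a') _ _) _.
rewrite -[leRHS]addrA; apply: lerD => //.
apply: le_trans (wdist_triangle (Xc _) o0 (lift_node r b') _ _) _.
rewrite [leRHS]addrC; apply: lerD => //.
by rewrite (wdistC (Xc _)).
Qed.

Lemma ldist_wdist : exists v : 'I_lam -> R, [/\ forall i, 0 < v i,
  forall i, F v i = rho * v i &
  forall n (x y : gnode (Xi S n)),
    (fun k => (level_dist k (to_lnode x) (to_lnode y))%:R / (gdiam (Xi S k))%:R : R)
      @ \oo --> wdist v x y / rho ^+ n].
Proof.
have [D [v [DS v0 Dv Fv]]] := rho_min_eigenvector R wfS primS.
have [L L0 ec] := iter_sub_weight_cvg wfS primS DS v0 Dv Fv (fun=> ltr01).
have v0' i : 0 <= v i by apply: ltW.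
have dc := gdiam_cvg v0 L0 Fv ec.
set u := (fun n => _) in dc.
have gc n (x y : gnode (Xi S n)) :
  (fun r => (gdist (lift_node r x) (lift_node r y))%:R / rho ^+ (r + n)) @ \oo -->
    L * (wdist v x y / rho ^+ n).
  apply/cvgrPdist_le => e e0; have [N HN] := gdist_cvg v0 L0 ec n e0.
  by exists N => // r /= /HN H; rewrite distrC; apply: H.
have [a [b ab]] := start_ends.
(* Two distinct nodes of the start graph keep the normalised diameters away from 0. *)
have d0 : 0 < limn u.
  have [i0 _] := some_color wfS; have [lo vlo] := finite_argmin i0 v.
  apply: (@lt_le_trans _ _ (L * (wdist v a b / rho ^+ 0))).
    rewrite mulr_gt0 // divr_gt0 //; apply: lt_le_trans (v0 lo) _.
    exact: (wdist_ge (Xc 0%N)).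
  apply: (@ler_cvg_to _ _ _ _ _ (fun r => u (r + 0)%N) _ _ (gc 0%N a b)).
    by rewrite (cvg_shiftn 0 u).
  apply: nearW => r; rewrite /u ler_pM2r ?invr_gt0 // ler_nat.
  exact: gdist_le_gdiam.
(* Rescaling the eigenvector by L over the limit of the normalised diameters leaves no constant in
   the formula for the limit metric. *)
exists (fun i => L / limn u * v i); split.
- by move=> i; rewrite mulr_gt0 // divr_gt0.
- move=> i; rewrite sub_weight_scale // ?Fv ?mulrA 1?[_ * rho]mulrC ?mulrA //.
  by rewrite divr_ge0 // ltW.
move=> n x y; rewrite wdist_scale // ?divr_ge0 ?ltW //.
rewrite -(cvg_shiftn n) /=.
have -> : L / limn u * wdist v x y / rho ^+ n =
    L * (wdist v x y / rho ^+ n) * (limn u)^-1 by ring.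
have H : (fun r => (gdist (lift_node r x) (lift_node r y))%:R / rho ^+ (r + n) *
    (u (r + n)%N)^-1) @ \oo --> L * (wdist v x y / rho ^+ n) * (limn u)^-1.
  apply: cvgM; first exact: gc.
  by apply: cvgV; [rewrite gt_eqF | rewrite (cvg_shiftn n u)].
apply: cvg_trans H; apply: near_eq_cvg; apply: nearW => r /=.
rewrite -(to_lnode_lift r x) -(to_lnode_lift r y) level_distE /u.
by rewrite invfM invrK mulrA [_ / _ * _]mulrAC mulfVK // gt_eqF.
Qed.

End Metric.

(** * The limit metric on nodes and arcs *)

Section Points.
Variables (R : realType) (lam : nat) (S : igs lam).
Hypothesis wfS : wf_igs S.
Hypothesis primS : primitive_igs S.
Local Notation rho := (rho_min R S).
Local Notation F := (@sub_weight R lam S).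

Let rho0 := rho_min_gt0 R wfS primS.
Let rn0 := rho_min_expr_gt0 R wfS primS.
Let Xc n : connected_graph (Xi S n) := @Xi_connected lam S wfS n.
Arguments Xc : clear implicits.

Lemma larc_anc (e : larc S) r m : arc_anc (e (r + m)%N) = e m.
Proof. by elim: r => [//|r IH] /=; rewrite (larcP e (r + m)) IH. Qed.

Lemma ext_iter r m (w : 'I_lam -> R) (f : gnode (Xi S m) -> R) :
  (forall i, 0 <= w i) -> arc_lipschitz (iter r F w) f ->
  exists2 g : gnode (Xi S (r + m)) -> R, arc_lipschitz w g &
    forall (a : garc (Xi S (r + m))) lo hi,
      lo <= f (abeg _ (arc_anc a)) <= hi -> lo <= f (aend _ (arc_anc a)) <= hi ->
      lo <= g (abeg _ a) <= hi /\ lo <= g (aend _ a) <= hi.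
Proof.
elim: r w => [|r IH] w w0 fL; first by exists f.
have Fw0 i : 0 <= F w i by apply: sub_weight_ge0.
rewrite iterSr in fL; have [g gL gr] := IH _ Fw0 fL.
exists (ext_node (G := Xi S (r + m)) w g); first exact: (ext_lipschitz wfS w0 gL).
move=> a lo hi H1 H2; have [H3 H4] := gr _ _ _ H1 H2.
exact: (ext_range wfS w0 gL).
Qed.

Definition share_end (G : cgraph lam) (a b : garc G) : bool :=
  [|| abeg G a == abeg G b, abeg G a == aend G b,
      aend G a == abeg G b | aend G a == aend G b].

Section LimitMetric.
Variable v : 'I_lam -> R.
Hypothesis v0 : forall i, 0 < v i.
Hypothesis Fv : forall i, F v i = rho * v i.
Hypothesis lv : forall n (x y : gnode (Xi S n)),
    (fun k => (level_dist k (to_lnode x) (to_lnode y))%:R / (gdiam (Xi S k))%:R : R)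
      @ \oo --> wdist v x y / rho ^+ n.

Let v0' i : 0 <= v i. Proof. exact: ltW. Qed.

Lemma ldistE n (x y : gnode (Xi S n)) :
  ldist R (to_lnode x) (to_lnode y) = wdist v x y / rho ^+ n.
Proof. by apply: cvg_lim; [exact: norm_hausdorff | exact: lv]. Qed.

Lemma common_level (x y z : lnode S) : exists n (a b c : gnode (Xi S n)),
  [/\ to_lnode a = x, to_lnode b = y & to_lnode c = z].
Proof.
have [N1 H1] := to_lnode_surj x; have [N2 H2] := to_lnode_surj y.
have [N3 H3] := to_lnode_surj z; pose n := maxn N1 (maxn N2 N3).
have [a <-] := H1 n (leq_maxl _ _).
have [b <-] := H2 n (leq_trans (leq_maxl N2 N3) (leq_maxr _ _)).
have [c <-] := H3 n (leq_trans (leq_maxr N2 N3) (leq_maxr _ _)).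
by exists n, a, b, c.
Qed.

Lemma ldist_ge0 (x y : lnode S) : 0 <= ldist R x y :> R.
Proof.
have [n [a [b [_ [<- <- _]]]]] := common_level x y y.
by rewrite ldistE; apply: divr_ge0; [exact: wdist_ge0 | exact: ltW].
Qed.

Lemma ldistxx (x : lnode S) : ldist R x x = 0.
Proof.
have [n [a [_ [_ [<- _ _]]]]] := common_level x x x.
by rewrite ldistE wdistxx // mul0r.
Qed.

Lemma ldistC (x y : lnode S) : ldist R x y = ldist R y x.
Proof.
have [n [a [b [_ [<- <- _]]]]] := common_level x y y.
by rewrite !ldistE (wdistC (Xc n) v0').
Qed.

Lemma ldist_triangle (y x z : lnode S) : ldist R x z <= ldist R x y + ldist R y z.
Proof.
have [n [a [b [c [<- <- <-]]]]] := common_level x y z.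
by rewrite !ldistE -mulrDl ler_pM2r ?invr_gt0 // wdist_triangle.
Qed.

Lemma ldist_le1 (x y : lnode S) : ldist R x y <= 1.
Proof.
have [n [a [b [_ [<- <- _]]]]] := common_level x y y.
rewrite /ldist; apply: limr_le; first exact: (cvgP (wdist v a b / rho ^+ n) (@lv n a b)).
exists n => // k /= nk; rewrite -(subnK nk).
rewrite -(to_lnode_lift (k - n) a) -(to_lnode_lift (k - n) b) level_distE.
set g := gdiam _.
have H : (gdist (lift_node (k - n) a) (lift_node (k - n) b) <= g)%N.
  exact: gdist_le_gdiam.
have [->|g0] := posnP g; first by rewrite invr0 mulr0.
by rewrite ler_pdivrMr ?ltr0n // mul1r ler_nat.
Qed.

Lemma rep_node_near : exists2 K : R, 0 < K & forall (p : lpoint S) r m,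
  ldist R (rep_node p (r + m)) (rep_node p m) <= K / rho ^+ m.
Proof.
have [K K0 near] := anc_near wfS primS v0 Fv; exists K => // -[x|e] r m /=.
  by rewrite ldistxx divr_ge0 // ltW.
rewrite -(to_lnode_lift r (abeg _ (e m))) ldistE ler_pdivrMr //.
rewrite exprD mulrA mulrAC divfK ?gt_eqF //.
by have := near r m (e (r + m)%N); rewrite larc_anc.
Qed.

Lemma pdist_cvg (p q : lpoint S) :
  cvgn (fun n => ldist R (rep_node p n) (rep_node q n)).
Proof.
have [K K0 near] := rep_node_near.
apply: cvg_of_tails => e e0.
have [m Hm] := rho_min_scale wfS primS (mulrn_wgt0 2 K0) e0.
exists (ldist R (rep_node p m) (rep_node q m)), m => n mn.
rewrite -(subnK mn); move: (n - m)%N => r.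
have Hp := near p r m; have Hq := near q r m.
apply: le_lt_trans Hm; rewrite mulr2n mulrDl ler_distl lerBlDr.
set p' := rep_node p _ in Hp *; set q' := rep_node q _ in Hq *.
set p0 := rep_node p m in Hp *; set q0 := rep_node q m in Hq *.
have T1 := ldist_triangle p0 p' q'; have T2 := ldist_triangle q0 p0 q'.
have T3 := ldist_triangle p' p0 q0; have T4 := ldist_triangle q' p' q0.
rewrite (ldistC q0 q') in T2; rewrite (ldistC p0 p') in T3.
move: (ldist R p' p0) (ldist R q' q0) (ldist R p0 q0) (ldist R p' q')
  (ldist R p0 q') (ldist R p' q0) (K / _) Hp Hq T1 T2 T3 T4.
by move=> *; apply/andP; split; lra.
Qed.

Lemma pdist_le (p q : lpoint S) (c : R) N :
  (forall n, (N <= n)%N -> ldist R (rep_node p n) (rep_node q n) <= c) ->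
  pdist R p q <= c.
Proof.
by move=> H; apply: limr_le; [exact: pdist_cvg | exists N].
Qed.

Lemma pdist_ge (p q : lpoint S) (c : R) N :
  (forall n, (N <= n)%N -> c <= ldist R (rep_node p n) (rep_node q n)) ->
  c <= pdist R p q.
Proof.
by move=> H; apply: limr_ge; [exact: pdist_cvg | exists N].
Qed.

(** Normalised distances are at most 1; without an upper bound the [sup] in [box_diam] would be a
    default value. *)
Lemma box_has_ubound (U : box S) :
  has_ubound [set pdist R p q | p in box_points U & q in box_points U].
Proof.
exists 1 => _ [p _ [q _ <-]]; apply: (@pdist_le _ _ _ 0%N) => n _.
exact: ldist_le1.
Qed.

Lemma pdist_le_box_diam (U : box S) p q : box_points U p -> box_points U q ->
  pdist R p q <= box_diam R U.
Proof.
move=> pU qU; apply: ub_le_sup; first exact: box_has_ubound.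
by exists p => //; exists q.
Qed.

Lemma box_diam_ge0 (U : box S) : 0 <= box_diam R U.
Proof.
have [[p pU]|H] := pselect (exists p, box_points U p).
  apply: le_trans (pdist_le_box_diam pU pU).
  by apply: (@pdist_ge _ _ _ 0%N) => n _; apply: ldist_ge0.
rewrite /box_diam (_ : [set _ | _ in _ & _ in _] = set0) ?sup0 //.
by apply/seteqP; split=> // t [p pU _]; apply: H; exists p.
Qed.

Lemma box_diam_le (U : box S) (c : R) : 0 <= c ->
  (forall p q, box_points U p -> box_points U q -> pdist R p q <= c) ->
  box_diam R U <= c.
Proof.
move=> c0 H; have [[p pU]|HU] := pselect (exists p, box_points U p).
  apply: sup_le_ub; first by exists (pdist R p p); exists p => //; exists p.
  by move=> _ [a aU [b bU <-]]; apply: H.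
rewrite /box_diam (_ : [set _ | _ in _ & _ in _] = set0) ?sup0 //.
by apply/seteqP; split=> // t [p pU _]; apply: HU; exists p.
Qed.

(* Balls around the nodes of Xi m cover both the nodes and the arcs. *)
Lemma ball_cover : exists2 C : R, 0 < C & forall m,
  exists U : gnode (Xi S m) -> box S,
    [/\ forall u, box_diam R (U u) <= C / rho ^+ m,
        forall x, exists u, bnodes (U u) x &
        forall e, exists u, barcs (U u) e].
Proof.
have [K K0 near] := rep_node_near.
have [K' K'0 near'] := lift_near wfS primS v0 Fv.
have KK : 0 < K + K' by rewrite addr_gt0.
exists (2 * (K + K')) => [|m]; first by rewrite mulr_gt0.
(* The ball is a condition at each level n >= m rather than one on [pdist], so that the triangle
   inequality of [ldist] suffices. In the radius, K' serves the nodes and K the arcs. *)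
pose B (u : gnode (Xi S m)) : set (lpoint S) :=
  [set p | forall n, (m <= n)%N ->
    ldist R (rep_node p n) (to_lnode u) <= (K + K') / rho ^+ m].
exists (fun u => Box [set x | B u (inl x)] [set e | B u (inr e)]); split.
- move=> u; apply: box_diam_le.
    by rewrite divr_ge0 ?mulr_ge0 // ltW.
  have BU p : box_points (Box [set x | B u (inl x)] [set e | B u (inr e)]) p -> B u p.
    by case=> -[x xB <-].
  move=> p q /BU pB /BU qB; apply: (@pdist_le _ _ _ m) => n mn.
  apply: le_trans (ldist_triangle (to_lnode u) _ _) _.
  rewrite [ldist R (to_lnode u) _]ldistC -mulrA mulrDl mul1r.
  by apply: lerD; [exact: pB | exact: qB].
- move=> x; have [N HN] := to_lnode_surj x.
  have [a ax] := HN (N + m)%N (leq_addr _ _).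
  have [u Hu] := near' N m a; exists u => n _ /=.
  rewrite -ax -(to_lnode_lift N u) ldistE ler_pdivrMr //.
  rewrite exprD [rho ^+ N * _]mulrC mulrA divfK ?gt_eqF //.
  by apply: le_trans Hu _; rewrite ler_pM2r // lerDr ltW.
- move=> e; exists (abeg _ (e m)) => n mn.
  have := near (inr e) (n - m)%N m; rewrite subnK //= => H.
  apply: le_trans H _; rewrite ler_pM2r ?invr_gt0 // lerDl ltW //.
Qed.

Lemma separation_const : exists2 c : R, 0 < c & forall i, c <= v i.
Proof.
have [i0 _] := some_color wfS; have [lo vlo] := finite_argmin i0 v.
by exists (v lo).
Qed.

Lemma node_separation (c : R) m (x y : gnode (Xi S m)) : (forall i, c <= v i) ->
  x != y -> c / rho ^+ m <= pdist R (inl (to_lnode x)) (inl (to_lnode y)).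
Proof.
move=> cv xy; apply: (@pdist_ge _ _ _ 0%N) => n _ /=.
by rewrite ldistE ler_pM2r ?invr_gt0 // wdist_ge.
Qed.

(** The potential is c rho^r at the ends of [x m] and 0 at all other nodes. Being constant on the
    ends of each of the two arcs, it extends with that same constant to their descendants, so the
    gap survives at every later level. *)
Lemma arc_separation (c : R) m (x y : larc S) : 0 <= c -> (forall i, c <= v i) ->
  ~~ share_end (x m) (y m) -> c / rho ^+ m <= pdist R (inr x) (inr y).
Proof.
move=> c0 cv /norP[n1 /norP[n2 /norP[n3 n4]]].
apply: (@pdist_ge _ _ _ m) => n mn /=; rewrite -(subnK mn).
move: (n - m)%N => r; rewrite ldistE ler_pdivlMr //.
rewrite exprD [rho ^+ r * _]mulrC mulrA divfK ?gt_eqF //.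
set a := x m in n1 n2 n3 n4; set b := y m in n1 n2 n3 n4.
pose f u : R := if (u == abeg _ a) || (u == aend _ a) then c * rho ^+ r else 0.
have cr : 0 <= c * rho ^+ r by rewrite mulr_ge0 // ltW.
have fL : arc_lipschitz (iter r F v) f.
  move=> e; rewrite (iter_sub_weight_eigen wfS primS v0 Fv).
  apply: (@le_trans _ _ (c * rho ^+ r)); last by rewrite mulrC ler_pM2l.
  by rewrite /f; do 2!case: ifP => _; rewrite ?subrr ?subr0 ?sub0r ?normr0 // ?normrN ger0_norm.
have [g gL gr] := ext_iter v0' fL.
have fa : f (abeg _ a) = c * rho ^+ r by rewrite /f eqxx.
have fa' : f (aend _ a) = c * rho ^+ r by rewrite /f eqxx orbT.
have fb : f (abeg _ b) = 0.
  by rewrite /f ![abeg _ b == _]eq_sym (negbTE n1) (negbTE n3).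
have fb' : f (aend _ b) = 0.
  by rewrite /f ![aend _ b == _]eq_sym (negbTE n2) (negbTE n4).
have [/andP[ga _] _] := gr (x (r + m)%N) (c * rho ^+ r) (c * rho ^+ r)
  ltac:(by rewrite larc_anc fa lexx) ltac:(by rewrite larc_anc fa' lexx).
have [/andP[_ gb] _] := gr (y (r + m)%N) 0 0
  ltac:(by rewrite larc_anc fb lexx) ltac:(by rewrite larc_anc fb' lexx).
have := lipschitz_wdist (Xc _) v0' (abeg _ (x (r + m)%N)) (abeg _ (y (r + m)%N)) gL.
apply: le_trans; apply: le_trans (ler_norm _); lra.
Qed.

End LimitMetric.
End Points.

(** * Counting nodes and arcs *)

Section Counting.
Variables (R : realType) (lam : nat) (S : igs lam).
Hypothesis wfS : wf_igs S.
Hypothesis primS : primitive_igs S.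
Local Notation rhoM := (spectral_radius R (Mmx S)).

Lemma rhoM_gt0 : 0 < rhoM.
Proof. by apply: lt_le_trans (spectral_radius_M_ge2 R wfS primS). Qed.

Let rM0 n : 0 < rhoM ^+ n.
Proof. by rewrite exprn_gt0 // rhoM_gt0. Qed.

Section Weighted.
Variable w : 'I_lam -> R.
Hypothesis w0 : forall i, 0 < w i.
Hypothesis Mw : forall i, act (Mmx S) w i = rhoM * w i.

(** With arcs weighted by a Perron vector of M, a substitution multiplies total weight by rho(M)
    exactly; plain counts follow up to a ratio of extreme entries of w. *)
Lemma sum_sub_arc (G : cgraph lam) (P : pred (garc G)) :
  \sum_(a : sub_arc S G | P (tag a)) w (color (subst_graph S G) a) =
  rhoM * \sum_(e | P e) w (color G e).
Proof.
rewrite mulr_sumr; under [RHS]eq_bigr do rewrite -Mw act_Mmx.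
rewrite (sig_big_dep P (fun _ _ => true)
  (fun e a => w (color (rules S (color G e)) a))) /=.
by apply: eq_bigl => a; rewrite andbT.
Qed.

Lemma sum_descendants r m (P : pred (garc (Xi S m))) :
  \sum_(a : garc (Xi S (r + m)) | P (arc_anc a)) w (color _ a) =
  rhoM ^+ r * \sum_(e | P e) w (color _ e).
Proof.
elim: r => [|r IH]; first by rewrite expr0 mul1r.
rewrite exprS -mulrA -IH.
exact: (@sum_sub_arc (Xi S (r + m)) (fun a => P (arc_anc a))).
Qed.

End Weighted.

Lemma card_descendants : exists2 c : R, 0 < c &
  forall r m (e : garc (Xi S m)),
    c * rhoM ^+ r <= #|[set a : garc (Xi S (r + m)) | arc_anc a == e]%SET|%:R.
Proof.
have [i0 _] := some_color wfS; have [w [w0 Mw]] := perron R i0 primS.1.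
have [lo wlo] := finite_argmin i0 w; have [hi whi] := finite_argmax i0 w.
exists (w lo / w hi) => [|r m e]; first by rewrite divr_gt0.
rewrite mulrAC ler_pdivrMr //.
have := sum_descendants Mw r (pred1 e); rewrite big_pred1_eq => E.
apply: (@le_trans _ _ (rhoM ^+ r * w (color _ e))).
  by rewrite mulrC ler_pM2l.
rewrite -E mulrC mulr_natr -sumr_const big_mkcond [leRHS]big_mkcond /=.
by apply: ler_sum => a _; rewrite !inE /=; case: ifP.
Qed.

Lemma card_arcs_le : exists2 c : R, 0 < c &
  forall n, #|garc (Xi S n)|%:R <= c * rhoM ^+ n.
Proof.
have [i0 _] := some_color wfS; have [w [w0 Mw]] := perron R i0 primS.1.
have [lo wlo] := finite_argmin i0 w.
pose W := \sum_(e : garc (Xi S 0)) w (color _ e).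
exists (W / w lo) => [|n].
  rewrite divr_gt0 // /W; case: wfS => _ /card_gt0P[e _] _ _.
  rewrite (bigD1 e) //= ltr_wpDr //; apply: sumr_ge0 => a _; exact: ltW.
rewrite mulrAC ler_pdivlMr //.
have := sum_descendants Mw n (m := 0) xpredT; rewrite addn0 /= mulrC -/W => <-.
rewrite mulrC mulr_natr -sumr_const; apply: ler_sum => a _; exact: wlo.
Qed.

(** As A and B are at distance at least 2, the first step of a simple path from z to the opposite
    end arrives at neither of them. *)
Lemma inner_neighbor i (z : gnode (rules S i)) :
  z = nodeA _ \/ z = nodeB _ ->
  exists e (y : inner S i), joins e z (val y).
Proof.
move=> zAB; have Rc := rule_connected wfS (i := i).
pose z' := if z == nodeA (rules S i) then nodeB (rules S i) else nodeA (rules S i).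
have d2 : 2 <= wdist (fun=> 1) z z' :> R.
  have : 2 <= wdist (fun=> 1) (nodeA (rules S i)) (nodeB (rules S i)) :> R.
    by rewrite -gdist_wdist // ler_nat; case: wfS => _ _ _; apply.
  rewrite /z'; case: zAB => ->; first by rewrite eqxx.
  by rewrite eq_sym (negbTE (nodeAB wfS i)) wdistC.
have [p pP] := ex_simple_path R z z' Rc.
have p2 : (2 <= size p)%N.
  case/and3P: pP => pw /eqP pz _; rewrite -(ler_nat R).
  apply: le_trans d2 _; rewrite -pz.
  apply: le_trans (@wdist_le R lam _ (fun=> 1) _ _ (fun=> ler01) pw) _.
  by rewrite /cost big_const_seq count_predT iter_addr_0.
case: p pP p2 => [|[e y] [|[e2 y2] p]] //= /and3P[/= /andP[ezy _] /eqP pz u] _.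
move: u => /and3P[zy yp _].
have yz' : y != z'.
  by apply: contraNneq yp => ->; rewrite -pz mem_last.
have yz : y != z by apply: contraNneq zy => ->; rewrite inE eqxx.
have yin : (y != nodeA (rules S i)) && (y != nodeB (rules S i)).
  move: yz' yz; rewrite /z'; case: zAB => ->; rewrite ?eqxx.
    by move=> -> ->.
  by rewrite [nodeB _ == _]eq_sym (negbTE (nodeAB wfS i)) => -> ->.
by exists e, (exist _ y yin).
Qed.

Lemma card_nodes_ge n : (#|garc (Xi S n)| <= #|gnode (Xi S n.+1)|)%N.
Proof.
have nei i : exists y : inner S i, True.
  by have [e [y _]] := inner_neighbor (or_introl (erefl (nodeA (rules S i)))); exists y.
pose f (e : garc (Xi S n)) : gnode (Xi S n.+1) :=
  inr (existT (fun e => inner S (color _ e)) e (sval (cid (nei (color _ e))))).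
apply: (leq_card f) => e e' E.
by have := congr1 (fun z => if z is inr t then tag t else e) E.
Qed.

Lemma card_nodes_le : exists2 c : R, 0 < c &
  forall n, #|gnode (Xi S n)|%:R <= c * rhoM ^+ n.
Proof.
have [c c0 Ec] := card_arcs_le.
have [K K0 RK] := rule_diam_bounded S.
(* The second term settles n = 0. The first makes the new nodes obey the same bound as the old ones,
   and the doubling is paid for by rho(M) >= 2. *)
pose c' := K%:R * c + #|gnode (start S)|%:R.
have Kc : 0 < K%:R * c by rewrite mulr_gt0 // ltr0n.
have c'0 : 0 < c' by rewrite /c' ltr_wpDr.
exists c' => //; elim=> [|n IH].
  by rewrite expr0 mulr1 /c' lerDr ltW.
have -> : #|gnode (Xi S n.+1)| = (#|gnode (Xi S n)| +
    \sum_(e : garc (Xi S n)) #|{: inner S (color _ e)}|)%N.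
  by rewrite card_sum card_tagged sumnE big_map big_enum.
rewrite natrD.
have H : (\sum_(e : garc (Xi S n)) #|{: inner S (color _ e)}|)%:R <= c' * rhoM ^+ n :> R.
  apply: (@le_trans _ _ (K%:R * (c * rhoM ^+ n))).
    apply: le_trans (ler_wpM2l (ler0n _ _) (Ec n)).
    rewrite -natrM ler_nat mulnC -sum_nat_const; apply: leq_sum => e _.
    by rewrite card_sig; apply: leq_trans (max_card _) (RK _).
  by rewrite mulrA ler_pM2r // /c' lerDl.
apply: le_trans (lerD IH H) _.
have := spectral_radius_M_ge2 R wfS primS => r2.
rewrite exprS mulrCA; have : 0 <= c' * rhoM ^+ n by rewrite mulr_ge0 // ltW.
move: (c' * _) => t t0; have : 0 <= (rhoM - 2) * t by rewrite mulr_ge0 // subr_ge0.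
by rewrite mulrBl; lra.
Qed.

Section PlaceEnds.
Variable G : cgraph lam.

Lemma place_inr (e e' : garc G) u w :
  @place lam S G e u = inr (existT (fun e => inner S (color G e)) e' w) -> e = e'.
Proof.
by case: placeP => // w' _ E; have := congr1 (fun z => if z is inr t then tag t else e) E.
Qed.

Lemma place_inl (e : garc G) u x :
  @place lam S G e u = inl x -> abeg G e = x \/ aend G e = x.
Proof. by case: placeP => // _ [->]; [left | right]. Qed.

End PlaceEnds.

(** One substitution gives a node u1 interior to the copy that replaces b; the next gives, at u1, an
    arc h whose other end is interior to the copy replacing an arc below b. Only arcs below b can
    meet these two nodes. *)
Lemma interior_arc n (b : garc (Xi S n)) : exists h : garc (Xi S n.+2),
  tag (tag h) = b /\ forall g, share_end h g -> tag (tag g) = b.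
Proof.
have [e1 [y1 j1]] := inner_neighbor (or_introl (erefl (nodeA (rules S (color _ b))))).
pose a1 : garc (Xi S n.+1) := existT _ b e1.
pose u1 : gnode (Xi S n.+1) := inr (existT (fun e => inner S (color (Xi S n) e)) b y1).
(* The arc e1 may point either way, so u1 is the A end or the B end of the copy replacing a1. *)
have [z zAB zu] : exists2 z : gnode (rules S (color _ a1)),
    z = nodeA _ \/ z = nodeB _ & @place lam S (Xi S n.+1) a1 z = inl u1.
  have [[_ E]|[E _]] := joins_ends j1.
    exists (nodeB (rules S (color _ a1))); first by right.
    by rewrite placeB // /= E place_inner.
  exists (nodeA (rules S (color _ a1))); first by left.
  by rewrite placeA /= E place_inner.
have [e2 [y2 j2]] := inner_neighbor zAB.
pose h : garc (Xi S n.+2) := existT _ a1 e2.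
exists h; split=> // g.
pose isend (x : gnode (Xi S n.+2)) := (abeg _ g == x) || (aend _ g == x).
have K1 : isend (inl u1) -> tag (tag g) = b.
  have H u : @place lam S (Xi S n.+1) (tag g) u = inl u1 -> tag (tag g) = b.
    by move=> /place_inl[] /place_inr.
  by rewrite /isend => /orP[] /eqP /H.
have K2 : isend (inr (existT (fun e => inner S (color (Xi S n.+1) e)) a1 y2)) ->
    tag (tag g) = b.
  have H u : @place lam S (Xi S n.+1) (tag g) u =
      inr (existT (fun e => inner S (color (Xi S n.+1) e)) a1 y2) -> tag (tag g) = b.
    by move=> /place_inr ->.
  by rewrite /isend => /orP[] /eqP /H.
have hend (x : gnode (Xi S n.+2)) : (x = abeg _ h) \/ (x = aend _ h) ->
    isend x -> tag (tag g) = b.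
  have [[E1 E2]|[E1 E2]] := joins_ends j2; rewrite /= E1 E2 zu place_inner;
    by case=> ->.
rewrite /share_end => /or4P[] /eqP E.
- by apply: (hend (abeg _ h)); [left | rewrite /isend E eqxx].
- by apply: (hend (abeg _ h)); [left | rewrite /isend E eqxx orbT].
- by apply: (hend (aend _ h)); [right | rewrite /isend E eqxx].
- by apply: (hend (aend _ h)); [right | rewrite /isend E eqxx orbT].
Qed.

(** Bundling an arc with its level makes [parent] a self-map, which can be iterated without
    dependent types; it fixes the arcs of level 0. *)
Definition level_arc : Type := {n : nat & garc (Xi S n)}.

Definition parent (x : level_arc) : level_arc :=
  match x with
  | existT n a =>
      match n return garc (Xi S n) -> level_arc with
      | 0 => fun a => existT _ 0%N a
      | n'.+1 => fun a => existT _ n' (tag (a : sub_arc S (Xi S n')))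
      end a
  end.

Definition arc_at (e : larc S) (n : nat) : level_arc := existT _ n (e n).

Lemma level_arc_inj n (a b : garc (Xi S n)) :
  existT (fun n => garc (Xi S n)) n a = existT _ n b -> a = b.
Proof.
move/eqP; rewrite (@eq_Tagged nat (fun n => garc (Xi S n)) (existT _ n a) b).
by move/eqP.
Qed.

Lemma tag_parent x : tag (parent x) = (tag x).-1.
Proof. by case: x => -[|n] a. Qed.

Lemma tag_iter_parent r x : tag (iter r parent x) = (tag x - r)%N.
Proof.
elim: r => [|r IH] /=; first by rewrite subn0.
by rewrite tag_parent IH subnS.
Qed.

Lemma iter_parent_anc r m (a : garc (Xi S (r + m))) :
  iter r parent (existT _ (r + m)%N a) = existT _ m (arc_anc a).
Proof.
elim: r a => [//|r IH] a; rewrite iterSr.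
exact: (IH (tag (a : sub_arc S (Xi S (r + m))))).
Qed.

Lemma larc_of_seq (s : nat -> level_arc) : (forall n, tag (s n) = n) ->
  (forall n, parent (s n.+1) = s n) -> exists e : larc S, forall n, arc_at e n = s n.
Proof.
move=> st sp.
have /all_sig[f fE] : forall n, {a : garc (Xi S n) | existT _ n a = s n}.
  by move=> n; have := st n; case: (s n) => m a /= E; subst m; exists a.
have fP n : tag (f n.+1 : sub_arc S (Xi S n)) = f n.
  by apply: level_arc_inj; rewrite fE -sp -fE.
by exists (LArc fP) => n; apply: fE.
Qed.

(* The children of x lie below an arc whose ends only meet arcs below x. *)
Lemma separated_children : exists2 c : R, 0 < c &
  forall k N, N%:R <= c * rhoM ^+ k -> forall x : level_arc,
  exists f : 'I_N -> level_arc, injective f /\ forall j,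
    [/\ tag (f j) = (k.+2 + tag x)%N, iter k.+2 parent (f j) = x &
        forall e e' : larc S, arc_at e (tag (f j)) = f j -> arc_at e' (tag x) <> x ->
          ~~ share_end (e (tag x).+2) (e' (tag x).+2)].
Proof.
have [c c0 cD] := card_descendants; exists c => // k N Nc [n b].
have [h [hb hg]] := interior_arc b.
(* Two levels lead from x to h and k more to its descendants. Only the last k levels multiply the
   number of arcs, so the loss is a factor independent of k. *)
set D := [set a : garc (Xi S (k + n.+2)) | arc_anc a == h]%SET.
have ND : (N <= #|D|)%N by rewrite -(ler_nat R); apply: le_trans Nc (cD _ _ _).
pose g (j : 'I_N) : garc (Xi S (k + n.+2)) := enum_val (widen_ord ND j).
have gh j : arc_anc (g j) = h.
  by have := enum_valP (widen_ord ND j); rewrite inE => /eqP.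
exists (fun j => existT _ (k + n.+2)%N (g j)); split.
  move=> j j' /level_arc_inj/enum_val_inj/(congr1 val)/= jj'.
  exact: val_inj.
move=> j; split=> /=; first by rewrite !addnS.
  by rewrite iter_parent_anc gh /= hb.
move=> e e' /level_arc_inj eg e'b.
have eh : e n.+2 = h by rewrite -(gh j) -eg larc_anc.
apply/negP; rewrite eh => /hg E.
have E' : tag (tag (e' n.+2 : sub_arc S (Xi S n.+1)) : sub_arc S (Xi S n)) = e' n.
  by rewrite (larcP e' n.+1) (larcP e' n).
by apply: e'b; rewrite /arc_at (etrans (esym E') E).
Qed.

End Counting.

(** * A Cantor set of separated arcs *)

(* The measure-theoretic content of the mass distribution principle: countably
   many cylinders of total uniform measure < 1 do not cover the words. *)
Lemma avoid_prefixes (R : realType) (N : nat) (i0 : 'I_N) (p : nat -> seq 'I_N) :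
  (\sum_(0 <= i <oo) ((N%:R : R) ^- size (p i))%:E < 1)%E ->
  exists w : nat -> 'I_N, forall i, mkseq w (size (p i)) <> p i.
Proof.
move=> lt1.
have N0 : 0 < N%:R :> R by rewrite ltr0n; apply: leq_ltn_trans (ltn_ord i0).
have t0 n : 0 < (N%:R : R) ^- n by rewrite invr_gt0 exprn_gt0.
pose m (q : seq 'I_N) i : \bar R :=
  if prefix q (p i) then ((N%:R : R) ^- size (p i))%:E else 0%E.
have m0 q i : (0 <= m q i)%E by rewrite /m; case: ifP => _; rewrite ?lee_fin ?(ltW (t0 _)).
(* The total measure of those given cylinders that lie in the cylinder of q; q is light when this is
   below the measure of q. Some child of a light word is light, and an infinite light branch avoids
   each [p i], which is not light itself. *)
pose sigma q := (\sum_(0 <= i <oo) m q i)%E.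
pose light q := (sigma q < ((N%:R : R) ^- size q)%:E)%E.
have light0 : light [::].
  rewrite /light /sigma /= expr0 invr1; under eq_eseriesr do rewrite /m prefix0s.
  exact: lt1.
have step q : light q -> exists a, light (rcons q a).
  move=> lq; apply: contrapT => /forallNP H; move: lq; apply/negP.
  rewrite -leNgt.
  have -> : ((N%:R : R) ^- size q)%:E = (\sum_(a < N) ((N%:R : R) ^- (size q).+1)%:E)%E.
    rewrite sumEFin sumr_const card_ord; congr _%:E.
    by rewrite -[RHS]mulr_natr exprSr invfM mulfVK // gt_eqF.
  apply: (@le_trans _ _ (\sum_(a < N) sigma (rcons q a))%E).
    apply: lee_sum => a _; have /negP := H a.
    by rewrite /light size_rcons -leNgt.
  rewrite /sigma -nneseries_sum //.
  apply: lee_nneseries => i _; first by move=> _; apply: sume_ge0 => a _; apply: m0.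
  rewrite /m; have [/prefixP[s ->]|qp] := boolP (prefix q (p i)); last first.
    rewrite big1 // => a _; rewrite ifF //; apply: contraNF qp.
    by apply: prefix_trans; rewrite -cats1 prefix_prefix.
  case: s => [|b s].
    rewrite cats0 big1 ?lee_fin ?(ltW (t0 _)) // => a _; rewrite ifF //.
    by apply/negP => /size_prefix; rewrite size_rcons ltnn.
  rewrite (bigD1 b) //= big1 ?adde0; last first.
    move=> a ab; rewrite ifF //; apply: contraNF ab.
    by rewrite -cats1 prefix_catr //= eqxx /= prefix0s andbT.
  by case: ifP => _; rewrite ?lee_fin ?(ltW (t0 _)).
pose next q := if pselect (exists a, light (rcons q a)) is left H
  then sval (cid H) else i0.
pose q n := iter n (fun q => rcons q (next q)) [::].
have lq n : light (q n).
  elim: n => [//|n /step H]; rewrite -[q n.+1]/(rcons (q n) (next (q n))) /next.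
  case: pselect => // H'.
  exact: (svalP (cid H')).
exists (fun n => next (q n)) => i E.
have qE n : mkseq (fun n => next (q n)) n = q n.
  by elim: n => [//|n IH]; rewrite mkseqS IH.
have := lq (size (p i)); rewrite -qE E /light; apply/negP; rewrite -leNgt.
rewrite /sigma (nneseriesD1 (n := i)) //.
have -> : m (p i) i = ((N%:R : R) ^- size (p i))%:E by rewrite /m prefix_refl.
by rewrite leeDl //; apply: nneseries_ge0 => n _ _; apply: m0.
Qed.

Section Words.
Variables (lam : nat) (S : igs lam) (k N : nat) (x0 : level_arc S).
Variable f : level_arc S -> 'I_N -> level_arc S.
Hypothesis x0_level : tag x0 = 0%N.
Hypothesis k0 : (0 < k)%N.
Hypothesis f_level : forall x j, tag (f x j) = (k + tag x)%N.
Hypothesis f_parent : forall x j, iter k (@parent lam S) (f x j) = x.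
Local Notation T := (foldl f x0).

Lemma tag_word q : tag (T q) = (size q * k)%N.
Proof.
elim/last_ind: q => [|q a IH] /=; first by rewrite x0_level.
by rewrite foldl_rcons f_level IH size_rcons mulSn.
Qed.

Lemma word_inj : (forall x, injective (f x)) ->
  forall q q', size q = size q' -> T q = T q' -> q = q'.
Proof.
move=> f_inj; elim/last_ind => [|q a IH] q'; first by case: q'.
case/lastP: q' => [|q' a']; first by rewrite size_rcons.
rewrite !size_rcons !foldl_rcons => -[sz] E.
have TE : T q = T q' by rewrite -(f_parent (T q) a) E f_parent.
by rewrite (IH _ sz TE) in E *; rewrite (f_inj _ _ _ E).
Qed.

Lemma iter_parent_word (w : nat -> 'I_N) r m :
  iter (r * k) (@parent lam S) (T (mkseq w (r + m))) = T (mkseq w m).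
Proof.
elim: r => [//|r IH].
by rewrite mulSn addnC iterD addSn mkseqS foldl_rcons f_parent.
Qed.

(** A word prescribes arcs at multiples of k only. Level n is filled in by an ancestor of the arc of
    the prefix of length n, which lies at level n k >= n. *)
Lemma word_larc (w : nat -> 'I_N) :
  exists e : larc S, forall n, arc_at e (n * k) = T (mkseq w n).
Proof.
pose s n := iter (n * k - n) (@parent lam S) (T (mkseq w n)).
have le n : (n <= n * k)%N by rewrite leq_pmulr.
have [||e eE] := @larc_of_seq lam S s.
- by move=> n; rewrite /s tag_iter_parent tag_word size_mkseq subKn.
- move=> n; rewrite /s -iterS -[RHS](congr1 _ (iter_parent_word w 1 n)) mul1n -iterD.
  have -> // : ((n.+1 * k - n.+1).+1 = n * k - n + k)%N.
  rewrite mulSn subnSK; last by rewrite -add1n leq_add.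
  by rewrite addnC addnBAC.
exists e => n; rewrite eE /s.
rewrite -mulnBl; have := iter_parent_word w (n * k - n) n.
by rewrite subnK.
Qed.

End Words.

Section SeparatedWords.
Variables (R : realType) (lam : nat) (S : igs lam).
Hypothesis wfS : wf_igs S.
Hypothesis primS : primitive_igs S.

(** If the prefixes of length m differ, the two arcs of the limit pass through different arcs at
    level [m * k.+2]. The next letter of [w] puts [X w] below an interior arc two levels further
    down, which meets nothing outside. *)
Lemma separated_words : exists2 c : R, 0 < c &
  forall k N, N%:R <= c * spectral_radius R (Mmx S) ^+ k ->
  exists X : (nat -> 'I_N) -> larc S, forall w w' m, mkseq w m <> mkseq w' m ->
    ~~ share_end (X w (m * k.+2).+2) (X w' (m * k.+2).+2).
Proof.
have [c c0 H] := separated_children R wfS primS; exists c => // k N Nc.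
pose f x := sval (cid (H k N Nc x)).
have fP x := svalP (cid (H k N Nc x)).
have f_inj x : injective (f x) := (fP x).1.
have f_level x j : tag (f x j) = (k.+2 + tag x)%N by have [] := (fP x).2 j.
have f_parent x j : iter k.+2 (@parent lam S) (f x j) = x by have [] := (fP x).2 j.
have /card_gt0P[e0 _] : (0 < #|garc (start S)|)%N by case: wfS.
pose x0 : level_arc S := existT _ 0%N e0.
have W w := cid (@word_larc lam S k.+2 N x0 f (erefl _) isT f_level f_parent w).
exists (fun w => sval (W w)) => w w' m ww'.
have E n := svalP (W w) n; have E' n := svalP (W w') n.
set e := sval (W w) in E *; set e' := sval (W w') in E' *.
pose x := foldl f x0 (mkseq w m).
have tx : tag x = (m * k.+2)%N by rewrite (@tag_word _ _ k.+2) // size_mkseq.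
have [_ _ sep] := (fP x).2 (w m).
rewrite -tx; apply: sep.
  by rewrite -[sval _]/(f x) f_level tx -mulSn E mkseqS foldl_rcons.
rewrite tx E' => xE; apply: ww'.
by apply: (@word_inj lam S k.+2 N x0 f f_parent f_inj); rewrite ?size_mkseq.
Qed.

End SeparatedWords.

(** * Dimensions *)

Lemma expr_unbounded (R : realType) (q A : R) : 1 < q -> exists k, A <= q ^+ k.
Proof.
move=> q1; have q0 : 0 < q by apply: lt_trans q1.
have [A0|A0] := leP A 0; first by exists 0%N; rewrite expr0 (le_trans A0).
have L0 : 0 < ln q by rewrite ln_gt0.
exists (Num.truncn (ln A / ln q)).+1.
rewrite -ler_ln ?posrE ?exprn_gt0 // lnXn // -mulr_natl -ler_pdivrMr //.
by apply/ltW/truncnS_gt.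
Qed.

Lemma powR_exprn (R : realType) (x s : R) n : 0 <= x ->
  (x ^+ n) `^ s = (x `^ s) ^+ n.
Proof.
move=> x0; elim: n => [|n IH]; first by rewrite !expr0 powR1.
by rewrite !exprS powRM ?exprn_ge0 // IH.
Qed.

Section Dimension.
Variables (R : realType) (lam : nat) (S : igs lam).
Hypothesis wfS : wf_igs S.
Hypothesis primS : primitive_igs S.
Local Notation rho := (rho_min R S).
Local Notation rhoM := (spectral_radius R (Mmx S)).
Local Notation dim := (ln rhoM / ln rho).

Let rho0 : 0 < rho := rho_min_gt0 R wfS primS.
Let rhoM0 : 0 < rhoM := rhoM_gt0 R wfS primS.
Let rn0 n : 0 < rho ^+ n. Proof. by rewrite exprn_gt0. Qed.
Let rMn0 n : 0 < rhoM ^+ n. Proof. by rewrite exprn_gt0. Qed.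

Let ln_rho : 0 < ln rho.
Proof. by rewrite ln_gt0 // (lt_le_trans _ (rho_min_ge2 R wfS primS)) // ltr1n. Qed.

Let ln_rhoM : 0 < ln rhoM.
Proof. by rewrite ln_gt0 // (lt_le_trans _ (spectral_radius_M_ge2 R wfS primS)) // ltr1n. Qed.

(** * Box counting *)

Section BoxCounting.
Variables (C c a1 a2 : R).
Hypotheses (C0 : 0 < C) (c0 : 0 < c) (a10 : 0 < a1) (a20 : 0 < a2).
Hypothesis cover : forall m, exists U : gnode (Xi S m) -> box S,
  (forall u, box_diam R (U u) <= C / rho ^+ m) /\
  forall x, exists u, bnodes (U u) x.
Hypothesis separated : forall m (x y : gnode (Xi S m)), x != y ->
  forall U : box S, bnodes U (to_lnode x) -> bnodes U (to_lnode y) ->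
  c / rho ^+ m <= box_diam R U.
Hypothesis card_ge : forall m, a1 * rhoM ^+ m <= #|gnode (Xi S m.+1)|%:R.
Hypothesis card_le : forall m, #|gnode (Xi S m)|%:R <= a2 * rhoM ^+ m.

Lemma coverable_nodes (l : R) m : C / rho ^+ m < l -> coverable S l #|gnode (Xi S m)|.
Proof.
move=> lC; have [U [Ud Uc]] := cover m.
exists (fun i => U (enum_val i)); split.
  by move=> i; apply: le_lt_trans (Ud _) lC.
move=> x _; have [u ux] := Uc x; exists (enum_rank u) => //=.
by rewrite enum_rankK.
Qed.

Lemma coverable_ge (l : R) m j : l <= c / rho ^+ m -> coverable S l j ->
  (#|gnode (Xi S m)| <= j)%N.
Proof.
move=> lc [U [Ud Uc]].
have pick (u : gnode (Xi S m)) : exists i, bnodes (U i) (to_lnode u).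
  by have [i _ H] := Uc (to_lnode u) I; exists i.
rewrite -[j]card_ord; apply: (leq_card (fun u => sval (cid (pick u)))) => u u' E.
apply/eqP; apply: contraT => uu'.
have Hu := svalP (cid (pick u)); have Hu' := svalP (cid (pick u')).
rewrite -E in Hu'; have := separated uu' Hu Hu'.
by rewrite leNgt (lt_le_trans (Ud _) lc).
Qed.

(** A finite cover exists at every positive scale, so the default value 0 of [Nbox] is not taken. *)
Lemma NboxP (l : R) : 0 < l -> coverable S l (Nbox S l) /\
  forall j, coverable S l j -> (Nbox S l <= j)%N.
Proof.
move=> l0; apply: (@xgetPex _ 0%N [set k | coverable S l k /\
  forall j, coverable S l j -> (k <= j)%N]).
have [m Hm] := rho_min_scale wfS primS C0 l0.
have ex : exists k, `[< coverable S l k >].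
  by exists #|gnode (Xi S m)|; apply/asboolP; apply: coverable_nodes.
case: (ex_minnP ex) => k /asboolP kP kmin; exists k; split=> // j jP.
by apply: kmin; apply/asboolP.
Qed.

Lemma ln_Nbox_bounded : exists K l0, [/\ 0 < K, 0 < l0, l0 < 1 & forall l : R, 0 < l -> l < l0 ->
  `|ln (Nbox S l)%:R - dim * (- ln l)| <= K].
Proof.
have rho1 : 1 < rho by rewrite (lt_le_trans _ (rho_min_ge2 R wfS primS)) // ltr1n.
(* A and B are numbers of levels that absorb the constants C and 1 / c. *)
have [A HA] := expr_unbounded C rho1.
have [B HB] := expr_unbounded c^-1 rho1.
pose K1 := `|ln a2| + (A.+1)%:R * ln rhoM.
pose K2 := `|ln a1| + (B.+2)%:R * ln rhoM.
(* Below this threshold m >= B.+1, so that the natural subtraction m - B.+1 is a true one; the extra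
   1 is the shift of level in [card_ge]. *)
exists (K1 + K2), (rho ^- B.+1); split.
- by rewrite addr_gt0 // ltr_wpDl // mulr_gt0 // ltr0n.
- by rewrite invr_gt0.
- by rewrite invf_lt1 // exprn_egt1.
move=> l l0 lB; pose t := - ln l / ln rho.
have tE : dim * - ln l = t * ln rhoM by rewrite /t; field; rewrite gt_eqF.
have tB : B.+1%:R < t.
  rewrite /t ltr_pdivlMr // mulr_natl -lnXn // -lnV // ltr_ln ?posrE ?invr_gt0 //.
  by rewrite -[ltLHS]invrK ltf_pV2 ?posrE ?invr_gt0.
have t0 : 0 <= t by apply: ltW; apply: lt_trans tB; rewrite ltr0n.
pose m := Num.truncn t.
have mt : m%:R <= t by rewrite /m; have /andP[] := truncn_itv t0.
have tm : t < m.+1%:R by rewrite /m; have /andP[] := truncn_itv t0.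
have lm1 : rho ^- m.+1 < l.
  rewrite -ltr_ln ?posrE ?invr_gt0 // lnV ?posrE // lnXn // ltrNl -mulr_natl.
  by rewrite -ltr_pdivrMr.
have lm : l <= rho ^- m.
  rewrite -ler_ln ?posrE ?invr_gt0 // lnV ?posrE // lnXn // lerNr -mulr_natl.
  by rewrite -ler_pdivlMr.
have Bm : (B.+1 <= m)%N.
  by rewrite -ltnS -(ltr_nat R) (lt_trans tB tm).
have [Nc Nmin] := NboxP l0.
have up : (Nbox S l)%:R <= a2 * rhoM ^+ (m.+1 + A).
  apply: le_trans (card_le _); rewrite ler_nat; apply: Nmin.
  apply: coverable_nodes; apply: le_lt_trans lm1.
  by rewrite ler_pdivrMr // exprD mulKf ?gt_eqF.
have lo : a1 * rhoM ^+ (m - B.+1) <= (Nbox S l)%:R.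
  apply: le_trans (card_ge _) _; rewrite ler_nat; apply: coverable_ge Nc.
  apply: le_trans lm _.
  have mE : m = ((m - B.+1).+1 + B)%N by rewrite addSnnS subnK.
  rewrite [in leLHS]mE exprD invfM [leLHS]mulrC ler_pM2r ?invr_gt0 //.
  by rewrite -[leRHS]invrK lef_pV2 ?posrE ?invr_gt0.
have N0 : 0 < (Nbox S l)%:R :> R by apply: lt_le_trans lo; rewrite mulr_gt0.
have lnup : ln (Nbox S l)%:R <= ln a2 + (m.+1 + A)%:R * ln rhoM.
  rewrite mulr_natl -lnXn // -lnM ?posrE // ler_ln ?posrE //.
  by rewrite mulr_gt0.
have lnlo : ln a1 + (m - B.+1)%:R * ln rhoM <= ln (Nbox S l)%:R.
  rewrite mulr_natl -lnXn // -lnM ?posrE // ler_ln ?posrE //.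
  by rewrite mulr_gt0.
have l1 := ler_norm (ln a2); have l2 : - ln a1 <= `|ln a1| by rewrite -normrN ler_norm.
have mtL : m%:R * ln rhoM <= t * ln rhoM by rewrite ler_pM2r.
have tmL : t * ln rhoM <= m%:R * ln rhoM + ln rhoM.
  by rewrite -[X in _ + X]mul1r -mulrDl ler_pM2r // natr1 ltW.
rewrite addSnnS natrD mulrDl in lnup.
rewrite natrB // mulrBl in lnlo.
have K20 : 0 <= K2 by rewrite addr_ge0 ?normr_ge0 // mulr_ge0 // ltW.
have K10 : 0 <= K1 by rewrite addr_ge0 ?normr_ge0 // mulr_ge0 // ltW.
have K2E : K2 = `|ln a1| + B.+1%:R * ln rhoM + ln rhoM.
  by rewrite /K2 -[B.+2%:R]natr1 mulrDl mul1r addrA.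
rewrite tE ler_distl; apply/andP; split.
  rewrite lerBlDr; apply: le_trans tmL _.
  apply: (@le_trans _ _ (ln (Nbox S l)%:R + K2)); last by rewrite lerD2l lerDr.
  apply: le_trans _ (lerD lnlo (lexx K2)); rewrite K2E.
  set mL := m%:R * _; set bL := B.+1%:R * _; set L := ln rhoM.
  have -> : ln a1 + (mL - bL) + (`|ln a1| + bL + L) = mL + L + (`|ln a1| - - ln a1).
    by ring.
  by rewrite lerDl subr_ge0.
apply: le_trans lnup _; rewrite addrCA; apply: lerD mtL _.
by apply: ler_wpDr => //; rewrite lerD2r.
Qed.

Lemma box_ratio_cvg : box_ratio R S l @[l --> (0 : R)^'+] --> dim.
Proof.
have [K [l0 [K0 l00 l01 HK]]] := ln_Nbox_bounded.
apply/cvgrPdist_le => e e0; near=> l.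
have lp : 0 < l by near: l; exact: nbhs_right_gt.
have ll0 : l < l0 by near: l; exact: nbhs_right_lt.
have le : l < expR (- (K / e)) by near: l; apply: nbhs_right_lt; apply: expR_gt0.
have lnl : K / e < - ln l by rewrite ltrNr -ltr_expR lnK.
have lnl0 : 0 < - ln l by apply: lt_trans lnl; rewrite divr_gt0.
rewrite distrC /box_ratio.
have -> : ln (Nbox S l)%:R / - ln l - dim =
    (ln (Nbox S l)%:R - dim * - ln l) / - ln l.
  by rewrite mulrBl mulfK // gt_eqF.
rewrite normrM [X in _ * X]gtr0_norm ?invr_gt0 // ler_pdivrMr //.
apply: le_trans (HK _ lp ll0) _.
by rewrite mulrC -ler_pdivrMr // ltW.
Unshelve. all: by end_near. Qed.

End BoxCounting.

Lemma hausdorff_pre_ge0 (T : Type) (part : box S -> set T) (s d : R) :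
  (0 <= hausdorff_pre part s d)%E.
Proof.
apply: le_ereal_inf_tmp => _ [I [U [_ _ ->]]]; apply: esum_ge0 => i _.
by rewrite lee_fin powR_ge0.
Qed.

(** * Upper bound on the Hausdorff dimension, for nodes and arcs alike *)

Section HausdorffUpper.
Variables (T : Type) (part : box S -> set T) (C a2 : R).
Hypotheses (C0 : 0 < C) (a20 : 0 < a2).
Hypothesis diam0 : forall U : box S, 0 <= box_diam R U.
Hypothesis cover : forall m, exists U : gnode (Xi S m) -> box S,
  (forall u, box_diam R (U u) <= C / rho ^+ m) /\
  forall x, exists u, part (U u) x.
Hypothesis card_le : forall m, #|gnode (Xi S m)|%:R <= a2 * rhoM ^+ m.

Lemma hausdorff_pre_level (s d : R) m : 0 <= s -> C / rho ^+ m <= d ->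
  (hausdorff_pre part s d <= (a2 * C `^ s * (rhoM / rho `^ s) ^+ m)%:E)%E.
Proof.
move=> s0 Cd; have [U [Ud Uc]] := cover m.
pose n := #|gnode (Xi S m)|.
have [u0] : exists u : gnode (Xi S m), True.
  by have /card_gt0P[u _] := Xi_node_gt0 wfS m; exists u.
move=> _; pose V (i : nat) : box S :=
  if insub i : option 'I_n is Some j then U (enum_val j) else U u0.
apply: ge_ereal_inf.
exists (\esum_(i in `I_n) (box_diam R (V i) `^ s)%:E)%E.
  exists `I_n, V; split=> //.
    by move=> i _; rewrite /V; case: insub => [j|]; apply: le_trans (Ud _) Cd.
  move=> x _; have [u ux] := Uc x; exists (enum_rank u : nat) => /=; first exact: ltn_ord.
  by rewrite /V valK enum_rankK.
rewrite esum_fset //; last by move=> i _; rewrite lee_fin powR_ge0.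
rewrite -fsbig_ord sumEFin lee_fin.
apply: (@le_trans _ _ (\sum_(i < n) (C / rho ^+ m) `^ s)).
  apply: ler_sum => i _; rewrite /V valK.
  by apply: ge0_ler_powR; rewrite ?nnegrE ?divr_ge0 ?(ltW C0) ?(ltW (rn0 m)).
rewrite sumr_const card_ord -[leLHS]mulr_natr.
have -> : (C / rho ^+ m) `^ s = C `^ s * (rho `^ s) ^- m.
  rewrite powRM ?invr_ge0 ?(ltW C0) ?(ltW (rn0 m)) //; congr (_ * _).
  by rewrite -powR_inv1 ?(ltW (rn0 m)) // powRAC powR_inv1 ?powR_ge0 // powR_exprn ?ltW.
rewrite expr_div_n.
have -> : a2 * C `^ s * (rhoM ^+ m / (rho `^ s) ^+ m) =
  C `^ s * (rho `^ s) ^- m * (a2 * rhoM ^+ m) by ring.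
by apply: ler_wpM2l; [rewrite divr_ge0 ?exprn_ge0 ?powR_ge0 | exact: card_le].
Qed.

Lemma hausdorff_measure_eq0 (s : R) : dim < s -> hausdorff_measure part s = 0%E.
Proof.
move=> ds; have s0 : 0 <= s by apply/ltW/(lt_trans _ ds); rewrite divr_gt0.
have q1 : 1 < rho `^ s / rhoM.
  rewrite ltr_pdivlMr // mul1r -ltr_ln ?posrE ?powR_gt0 // ln_powR.
  by rewrite -ltr_pdivrMr.
have rho1 : 1 < rho by rewrite (lt_le_trans _ (rho_min_ge2 R wfS primS)) // ltr1n.
apply: lim_near_cst; first exact: ereal_hausdorff.
near=> d; have d0 : 0 < d by near: d; exact: nbhs_right_gt.
apply/eqP; rewrite eq_le hausdorff_pre_ge0 andbT.
apply/lee_addgt0Pr => e e0; rewrite add0e.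
pose B := a2 * C `^ s.
have B0 : 0 < B by rewrite mulr_gt0 ?powR_gt0.
(* The m1 levels make the boxes smaller than d, the m2 levels make the sum smaller than e. *)
have [m1 Hm1] := expr_unbounded (C / d) rho1.
have [m2 Hm2] := expr_unbounded (B / e) q1.
apply: le_trans (@hausdorff_pre_level s d (m1 + m2) s0 _) _.
  rewrite ler_pdivrMr // mulrC -ler_pdivrMr //; apply: le_trans Hm1 _.
  by rewrite exprD ler_peMr ?(ltW (rn0 m1)) // exprn_ege1 // ltW.
rewrite lee_fin -/B.
have -> : rhoM / rho `^ s = (rho `^ s / rhoM)^-1 by rewrite invf_div.
rewrite exprVn ler_pdivrMr; last by rewrite exprn_gt0 // (lt_trans _ q1).
rewrite mulrC -ler_pdivrMr //; apply: le_trans Hm2 _.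
rewrite addnC exprD ler_peMr //; last by rewrite exprn_ege1 // ltW.
by rewrite exprn_ge0 // ltW // (lt_trans _ q1).
Unshelve. all: by end_near. Qed.

Lemma hausdorff_dim_le : (hausdorff_dim R part <= dim%:E)%E.
Proof.
apply/lee_addgt0Pr => e e0; apply: ereal_inf_lbound.
exists (dim + e) => //=; split; first by rewrite addr_ge0 ?divr_ge0 // ltW.
by apply: hausdorff_measure_eq0; rewrite ltrDl.
Qed.

End HausdorffUpper.

(** * Lower bound by mass distribution *)

Section HausdorffLower.
Hypothesis diam0 : forall U : box S, 0 <= box_diam R U.
Hypothesis diam_ge : forall (U : box S) p q, box_points U p -> box_points U q ->
  pdist R p q <= box_diam R U.

(* Mass distribution principle: the uniform measure of the cylinder of length m
   is at most the s-th power of the scale c * r ^+ m, up to a constant. *)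
Lemma cover_mass (N : nat) (i0 : 'I_N) (c r s : R) (X : (nat -> 'I_N) -> larc S) :
  (1 < N)%N -> 0 < c -> 0 < r -> r < 1 -> 0 <= s -> N%:R^-1 <= r `^ s ->
  (forall w w' m, mkseq w m <> mkseq w' m -> c * r ^+ m <= pdist R (inr (X w)) (inr (X w'))) ->
  exists2 kappa : R, 0 < kappa & forall d, (kappa%:E <= hausdorff_pre (@barcs lam S) s d)%E.
Proof.
move=> N1 c0 r0 r1 s0 Nr sep.
have N0 : 0 < N%:R :> R by rewrite ltr0n ltnW.
have NN1 : 1 < N%:R :> R by rewrite ltr1n.
have rn m : 0 < r ^+ m by rewrite exprn_gt0.
pose K := ((c * r) `^ s)^-1.
have K0 : 0 < K by rewrite invr_gt0 powR_gt0 // mulr_gt0.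
(* A length m is sought such that a box of diameter d determines the first m letters, while a
   cylinder of length m has measure at most K d^s. The allowance eta covers d = 0 and very small d,
   where a length depending on eta alone is used. *)
have scale (d eta : R) : 0 <= d -> 0 < eta ->
    exists m, (m = 0%N \/ d < c * r ^+ m) /\ N%:R ^- m <= K * d `^ s + eta.
  move=> d0 eta0; have [M HM] := expr_unbounded eta^-1 NN1.
  have HM' : N%:R ^- M <= eta.
    by rewrite -[leRHS]invrK lef_pV2 ?posrE ?invr_gt0 ?exprn_gt0.
  have KM : 0 <= K * d `^ s by rewrite mulr_ge0 ?powR_ge0 // ltW.
  have [dM|dM] := ltP d (c * r ^+ M).
    by exists M; split; [right | rewrite -[leLHS]add0r lerD].
  have ex : exists m, c * r ^+ m <= d by exists M.
  have small m : c * r ^+ m.+1 <= d -> N%:R ^- m <= K * d `^ s + eta.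
    move=> H; rewrite -[leLHS]addr0; apply: lerD; last exact: ltW.
    rewrite /K mulrC ler_pdivlMr ?powR_gt0 ?mulr_gt0 //.
    apply: le_trans (_ : (c * r ^+ m.+1) `^ s <= _); last first.
      by apply: ge0_ler_powR; rewrite ?nnegrE // ltW // mulr_gt0.
    have -> : c * r ^+ m.+1 = c * r * r ^+ m by rewrite exprS mulrA.
    rewrite [leRHS]powRM ?(ltW (rn m)) ?(ltW (mulr_gt0 c0 r0)) // mulrC.
    rewrite ler_pM2l ?powR_gt0 ?mulr_gt0 //.
    rewrite powR_exprn ?(ltW r0) // -exprVn.
    by apply: lerXn2r; rewrite ?nnegrE ?powR_ge0 // invr_ge0 ltW.
  (* The first exponent at which the scale drops to d is one too large: its predecessor is taken,
     and if there is none, the empty prefix. *)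
  case: (ex_minnP ex) => -[|m] Hm mmin.
    exists 0%N; split; first by left.
    apply: small; apply: le_trans Hm; rewrite expr0 expr1 ler_pM2l //.
    exact: ltW.
  exists m; split; last exact: small.
  by right; rewrite ltNge; apply/negP => /mmin; rewrite ltnn.
(* The total mass 1 is split in halves, one for K times the sum of the powers of the diameters and
   one for the allowances, which form a geometric series. *)
exists (2 * K)^-1 => [|d]; first by rewrite invr_gt0 mulr_gt0.
apply: le_ereal_inf_tmp => _ [I [U [_ cov ->]]].
rewrite leNgt; apply/negP => lt.
pose A i : \bar R := if i \in I then (box_diam R (U i) `^ s)%:E else 0%E.
have A0 i : (0 <= A i)%E by rewrite /A; case: ifP => _; rewrite ?lee_fin ?powR_ge0.
have eta0 i : 0 < 2^-1 / (2 ^ i.+1)%:R :> R by rewrite divr_gt0 // ltr0n expn_gt0.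
have pick i : exists p : seq 'I_N,
    ((N%:R ^- size p)%:E <= K%:E * A i + (2^-1 / (2 ^ i.+1)%:R)%:E)%E /\
    (I i -> forall w, barcs (U i) (X w) -> mkseq w (size p) = p).
  have [[Ii [w0 w0U]]|H] := pselect (I i /\ exists w0, barcs (U i) (X w0)).
    have [m [m0 Hm]] := scale (box_diam R (U i)) _ (diam0 (U i)) (eta0 i).
    exists (mkseq w0 m); rewrite size_mkseq; split.
      by rewrite /A mem_set // -EFinM -EFinD lee_fin.
    move=> _ w wU; apply: contrapT => ww0; case: m0 => [E|]; first by rewrite E in ww0.
    rewrite ltNge => /negP; apply; apply: le_trans (sep _ _ _ ww0) _.
    by apply: diam_ge; right; [exists (X w) | exists (X w0)].
  have [m [_ Hm]] := scale 0 _ (lexx 0) (eta0 i).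
  (* A box outside the family, or one that meets no [X w], constrains nothing: any word of small
     enough measure will do. *)
  have [M HM] := expr_unbounded (2^-1 / (2 ^ i.+1)%:R : R)^-1 NN1.
  exists (nseq M i0); rewrite size_nseq; split.
    apply: (@le_trans _ _ (2^-1 / (2 ^ i.+1)%:R)%:E).
      by rewrite lee_fin -[leRHS]invrK lef_pV2 ?posrE ?invr_gt0 ?exprn_gt0.
    by rewrite leeDr // mule_ge0 // lee_fin ltW.
  by move=> Ii w wU; exfalso; apply: H; split=> //; exists w.
pose p i := sval (cid (pick i)); have pP i := svalP (cid (pick i)).
have sumA : (\sum_(0 <= i <oo) A i = \esum_(i in I) (box_diam R (U i) `^ s)%:E)%E.
  by rewrite nneseries_esum // [RHS]esum_mkcond; congr esum; apply/seteqP.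
have tot : (\sum_(0 <= i <oo) ((N%:R : R) ^- size (p i))%:E < 1)%E.
  apply: (@le_lt_trans _ _ (\sum_(0 <= i <oo)
      (K%:E * A i + (2^-1 / (2 ^ i.+1)%:R)%:E))%E).
    apply: lee_nneseries => i _; last exact: (pP i).1.
    by move=> _; rewrite lee_fin invr_ge0 exprn_ge0 // ltW.
  have KA0 i : (0 <= K%:E * A i)%E by rewrite mule_ge0 // lee_fin ltW.
  apply: le_lt_trans (epsilon_trick xpredT KA0 _) _ => //.
  rewrite nneseriesZl // sumA.
  have -> : 1%E = ((2^-1)%:E + (2^-1)%:E)%E :> \bar R.
    by rewrite -EFinD; congr _%:E; lra.
  rewrite lteD2rE // -lte_pdivlMl // -EFinM.
  by rewrite mulrC -invfM.
have [w Hw] := avoid_prefixes i0 tot.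
have [i Ii wU] := cov (X w) Logic.I.
by apply: (Hw i); apply: (pP i).2.
Qed.

(** The pre-measure is monotone in delta, so that the limit at 0 exists and inherits the lower
    bound. *)
Lemma hausdorff_measure_neq0 (s kappa : R) : 0 < kappa ->
  (forall d, (kappa%:E <= hausdorff_pre (@barcs lam S) s d)%E) ->
  hausdorff_measure (@barcs lam S) s != 0%E.
Proof.
move=> k0 H; rewrite gt_eqF //; apply: (@lt_le_trans _ _ kappa%:E); first by rewrite lte_fin.
apply: lime_ge; last by apply: nearW.
apply: nonincreasing_at_right_is_cvge; near=> d => x y _ _ xy.
apply: ereal_inf_le_tmp => _ [I [U [Ud cov ->]]]; exists I, U; split=> // i Ii.
exact: le_trans (Ud i Ii) xy.
Unshelve. all: by end_near. Qed.

(** For s < dim one has rho(M) > rho^s, so for large k the b rho(M)^k available children outnumber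
    rho^(s (k + 2)): the constant b and the two extra levels are outweighed. *)
Lemma hausdorff_dim_ge (c : R) : 0 < c ->
  (forall (x y : larc S) m, ~~ share_end (x m) (y m) ->
    c / rho ^+ m <= pdist R (inr x) (inr y)) ->
  (dim%:E <= hausdorff_dim R (@barcs lam S))%E.
Proof.
move=> c0 sep; apply: le_ereal_inf_tmp => _ [s [s0 Hs] <-].
rewrite lee_fin leNgt; apply/negP => sd; move: Hs; apply/eqP.
have [b b0 words] := separated_words R wfS primS.
pose sg := rho `^ s.
have sg0 : 0 < sg by apply: powR_gt0.
have rho1 : 1 < rho by rewrite (lt_le_trans _ (rho_min_ge2 R wfS primS)) // ltr1n.
have sg1 : 1 <= sg by rewrite -[leLHS](powRr0 rho) ler_powR // ltW.
have q1 : 1 < rhoM / sg.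
  rewrite ltr_pdivlMr // mul1r -ltr_ln ?posrE // ln_powR.
  by rewrite -ltr_pdivlMr.
(* The square of sg pays for the two extra levels, and the added 2 for the rounding in N, which also
   makes N at least 2. *)
have [k Hk] := expr_unbounded ((sg ^+ 2 + 2) / b) q1.
pose N := (Num.truncn (sg ^+ k.+2)).+2.
have sgk n : 1 <= sg ^+ n by apply: exprn_ege1.
have sgN : sg ^+ k.+2 <= N%:R.
  by apply: le_trans (ltW (truncnS_gt _)) _; rewrite ler_nat.
have NM : N%:R <= b * rhoM ^+ k.
  apply: (@le_trans _ _ ((sg ^+ 2 + 2) * sg ^+ k)).
    rewrite /N -[_.+2]addn2 natrD mulrDl -exprD; apply: lerD.
      by rewrite truncn_le // (le_trans _ (sgk _)).
    by rewrite ler_peMr.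
  move: Hk; rewrite ler_pdivrMr // expr_div_n mulrAC ler_pdivlMr ?exprn_gt0 //.
  by rewrite [_ * b]mulrC.
have [X HX] := words k N NM.
have r0 : 0 < rho ^- k.+2 by rewrite invr_gt0.
(* Words are separated two levels below [m * k.+2], hence the constant c / rho^2. *)
have [|||||||kappa k0 Hk'] := @cover_mass N ord0 (c / rho ^+ 2) (rho ^- k.+2) s X.
- by [].
- by rewrite divr_gt0.
- by [].
- by rewrite invf_lt1 // exprn_egt1.
- by [].
- have -> : (rho ^- k.+2) `^ s = (sg ^+ k.+2)^-1.
    by rewrite -powR_inv1 ?(ltW (rn0 _)) // powRAC powR_inv1 ?powR_ge0 // powR_exprn ?ltW.
  by rewrite lef_pV2 ?posrE ?exprn_gt0 // ltr0n.
- move=> w w' m ww'; have := sep _ _ _ (HX w w' m ww').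
  by rewrite -addn2 exprD invfM [in _^-1 * _]mulrC mulrA mulnC exprM exprVn.
exact: hausdorff_measure_neq0 k0 Hk'.
Qed.

End HausdorffLower.

Lemma card_arcs_ge : exists2 c : R, 0 < c &
  forall n, c * rhoM ^+ n <= #|garc (Xi S n)|%:R.
Proof.
have [c c0 H] := card_descendants R wfS primS.
have /card_gt0P[e0 _] : (0 < #|garc (start S)|)%N by case: wfS.
exists c => // n; rewrite -[X in garc (Xi S X)]addn0.
by apply: le_trans (H n 0%N e0) _; rewrite ler_nat max_card.
Qed.

End Dimension.

Theorem theorem2p8 (R : realType) (lam : nat) (S : igs lam)
    (wfS : wf_igs S) (primS : primitive_igs S) :
  [/\ cvg (box_ratio R S l @[l --> (0 : R)^'+]),
      dimB R S = ln (spectral_radius R (Mmx S)) / ln (rho_min R S) &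
      dimH R S = (ln (spectral_radius R (Mmx S)) / ln (rho_min R S))%:E].
Proof.
have [v [v0 Fv lv]] := ldist_wdist R wfS primS.
have [C C0 cover] := ball_cover wfS primS v0 Fv lv.
have [c c0 cv] := separation_const wfS v0.
have [a1 a10 card_ge] := card_arcs_ge R wfS primS.
have [a2 a20 card_le] := card_nodes_le R wfS primS.
have diam0 := box_diam_ge0 wfS primS v0 Fv lv.
have diam_ge := pdist_le_box_diam wfS primS v0 Fv lv.
have coverN m : exists U : gnode (Xi S m) -> box S,
    (forall u, box_diam R (U u) <= C / rho_min R S ^+ m) /\
    forall x, exists u, bnodes (U u) x.
  by have [U [Ud Un _]] := cover m; exists U.
have coverA m : exists U : gnode (Xi S m) -> box S,
    (forall u, box_diam R (U u) <= C / rho_min R S ^+ m) /\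
    forall x, exists u, barcs (U u) x.
  by have [U [Ud _ Ua]] := cover m; exists U.
have node_sep m (x y : gnode (Xi S m)) : x != y ->
    forall U : box S, bnodes U (to_lnode x) -> bnodes U (to_lnode y) ->
    c / rho_min R S ^+ m <= box_diam R U.
  move=> xy U xU yU; apply: le_trans (node_separation wfS primS v0 Fv lv cv xy) _.
  by apply: diam_ge; left; [exists (to_lnode x) | exists (to_lnode y)].
have card_ge' m : a1 * spectral_radius R (Mmx S) ^+ m <= #|gnode (Xi S m.+1)|%:R.
  by apply: le_trans (card_ge m) _; rewrite ler_nat card_nodes_ge.
have box := box_ratio_cvg wfS primS C0 c0 a10 a20 coverN node_sep card_ge' card_le.
have HV := hausdorff_dim_le wfS primS C0 a20 diam0 coverN card_le.
have HE := hausdorff_dim_le wfS primS C0 a20 diam0 coverA card_le.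
have HE' := hausdorff_dim_ge wfS primS diam0 diam_ge c0
  (fun x y m => arc_separation wfS primS v0 Fv lv (ltW c0) cv).
split; first by apply/cvg_ex; eexists; exact: box.
  by apply: cvg_lim; [exact: norm_hausdorff | exact: box].
apply/eqP; rewrite eq_le /dimH ge_max le_max.
by rewrite /dimHV /dimHE HV HE HE' orbT.
Qed.
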